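(* Let $2\le p<\infty$. Let $\varphi\in S(\mathbb{D})$ with $\varphi\notin \mathrm{Aut}(\mathbb{D})$, and suppose that $\varphi$ has no fixed point in $\mathbb{D}$. Suppose further that the composition operator $C_\varphi$ is bounded on the Besov space $B_p$. Then $C_\varphi$ is not hypercyclic on $B_p$.
   Context: $\mathbb{D}=\{z\in\mathbb{C}:|z|<1\}$, $H(\mathbb{D})$ is the space of holomorphic functions on $\mathbb{D}$, $S(\mathbb{D})$ is the set of all holomorphic self-maps of $\mathbb{D}$, and $dA(z)=dx\,dy$ is Lebesgue area measure. $\mathrm{Aut}(\mathbb{D})$ is the set of one-to-one holomorphic maps of $\mathbb{D}$ onto itself. For $\varphi\in S(\mathbb{D})$, $C_\varphi f=f\circ\varphi$ for $f\in H(\mathbb{D})$. For $1<p<\infty$, the Besov space is $B_p=\{f\in H(\mathbb{D}):\|f\|_{B_p}^p=\int_{\mathbb{D}}|f'(z)|^p(1-|z|^2)^{p-2}\,dA(z)<\infty\}$, a Banach space under the norm $\|f\|_p$ given by $\|f\|_p^p=|f(0)|^p+\|f\|_{B_p}^p$. ''$C_\varphi$ is bounded on $B_p$'' means that $C_\varphi$ is a bounded linear operator from $B_p$ to $B_p$. A continuous linear operator $T$ on a separable infinite-dimensional Banach space $X$ is hypercyclic if there is $f\in X$ whose orbit $\{T^nf:n=0,1,2,\dots\}$ is dense in $X$. *)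

(* Defs.v *)
From mathcomp Require Import all_boot all_order all_algebra.
From mathcomp Require Import all_classical all_reals all_analysis.
From mathcomp Require Export complex.
Import Order.TTheory GRing.Theory Num.Theory.
Import numFieldNormedType.Exports.

Set Implicit Arguments.
Unset Strict Implicit.
Unset Printing Implicit Defensive.

Local Open Scope classical_set_scope.
Local Open Scope ring_scope.
Local Open Scope complex_scope.

(* An operator T on a space X of vectors of V, for the extended-real-valued
   functional nrm, which is meant to be a finite norm on X modulo vectors of
   norm 0. *)
Definition bounded_operator (K : numDomainType) (R : realType) (V : lmodType K)
    (X : set V) (nrm : V -> \bar R) (T : V -> V) : Prop :=
  [/\ linear T,
      (forall f, X f -> X (T f)) &
      exists M : R, forall f, X f -> (nrm (T f) <= M%:E * nrm f)%E].

Definition hypercyclic (K : numDomainType) (R : realType) (V : lmodType K)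
    (X : set V) (nrm : V -> \bar R) (T : V -> V) : Prop :=
  exists2 f, X f &
    forall g, X g -> forall e : R, 0 < e ->
      exists n : nat, (nrm (iter n T f - g)%R < e%:E)%E.

Definition unit_disk (R : realType) : set R[i] := [set z | `|z| < 1].

(* Functions on the disk are represented by total functions on R[i]; every
   notion below depends only on their values on the disk. Derivability is along
   the direction 1 of R[i]^o, that is R[i] as a normed space over itself, which
   is complex differentiability. The codomain R[i]^o also makes the functions a
   vector space over R[i] rather than over R. *)
Definition holomorphic_disk (R : realType) (f : R[i] -> R[i]^o) : Prop :=
  forall z, unit_disk z -> derivable (f : R[i]^o -> R[i]^o) z 1.

Definition self_map_disk (R : realType) (phi : R[i] -> R[i]) : Prop :=
  holomorphic_disk phi /\ (forall z, unit_disk z -> unit_disk (phi z)).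

Definition aut_disk (R : realType) (phi : R[i] -> R[i]) : Prop :=
  holomorphic_disk phi /\ set_bij (@unit_disk R) (@unit_disk R) phi.

(* The modulus as an element of R: `|z| has type R[i]. *)
Definition cmod (R : realType) (z : R[i]) : R := complex.Re `|z|.

Definition besov_integral (R : realType) (p : R) (f : R[i] -> R[i]^o) : \bar R :=
  (\int[lebesgue_measure \x lebesgue_measure]_(w in
       [set w : R * R | unit_disk (w.1 +i* w.2)])
     (let z : R[i] := w.1 +i* w.2 in
      (cmod (derive1 f z) `^ p * (1 - cmod z ^+ 2) `^ (p - 2))%:E))%E.

Definition besov (R : realType) (p : R) : set (R[i] -> R[i]^o) :=
  [set f | holomorphic_disk f /\ (besov_integral p f < +oo)%E].

Definition besov_norm (R : realType) (p : R) (f : R[i] -> R[i]^o) : \bar R :=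
  (((cmod (f 0) `^ p)%:E + besov_integral p f) `^ p^-1)%E.

Definition composition_operator (R : realType) (phi : R[i] -> R[i])
  (f : R[i] -> R[i]^o) : R[i] -> R[i]^o := f \o phi.

(* Main.v *)
Require Import Defs.
From mathcomp Require Import all_boot all_order all_algebra.
From mathcomp Require Import all_classical all_reals all_analysis.
From mathcomp Require Import measurable_realfun.
From mathcomp Require Import ring lra.
Import Order.TTheory GRing.Theory Num.Theory.
Import numFieldNormedType.Exports.

Set Implicit Arguments.
Unset Strict Implicit.
Unset Printing Implicit Defensive.

Local Open Scope classical_set_scope.
Local Open Scope ring_scope.
Local Open Scope complex_scope.

(** Write phi_n for the n-th iterate of phi. The orbit of f under the composition
    operator consists of the functions f o phi_n, whose derivative at 0 is
    f'(phi_n 0) phi_n'(0). Two estimates bound it independently of n: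
    - Schwarz-Pick: |phi_n'(0)| <= 96 (1 - |phi_n 0|) (self_map_derive1_le);
    - Besov functions are Bloch functions: |f'(w)| (1 - |w|) <= 512 (1 + S) when
      the Besov integral of f is at most S (besov_bloch).
    By the second estimate at w = 0, a function at Besov distance less than 1
    from f o phi_n has a derivative at 0 that differs from that of f o phi_n by
    at most 1024. Hence no element of the orbit is at distance less than 1 from
    z |-> l z when l is large, although this function belongs to B_p.

    Both estimates rest on Cauchy's formula, which is derived here from complex
    differentiability alone. Paths are boundaries of rectangles, since they fit
    the product measure: averaging over the position of a side is integration
    in one coordinate. Goursat's theorem follows by bisection (goursat) and
    survives an isolated singularity that is o(1/|z - w|) (contour_punctured);
    applied to (f z - f w)/(z - w)^2 - f'(w)/(z - w), this is Cauchy's formula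
    for f'(w) (cauchy_derivative). It gives Cauchy's estimate, hence
    Schwarz-Pick by composing with a disk automorphism, and the continuity of f'
    (derive1_continuous). An integration by parts then bounds |f'(w)| by the
    integral of |f'| along the sides of a rectangle around w
    (derive1_le_sides), Tonelli's theorem selects sides on which that integral
    is controlled by the area integral (derive1_le_area), and a pointwise
    comparison of |f'| with the Besov density concludes (le_besov_density). *)

(** * The modulus, and differentiability in epsilon-delta form *)

Section Modulus.
Variable R : realType.
Implicit Types (z w : R[i]) (x y : R).

Lemma normE z : `|z| = (cmod z)%:C.
Proof. by []. Qed.

Lemma cmodE z : cmod z = Num.sqrt (complex.Re z ^+ 2 + complex.Im z ^+ 2).
Proof. by case: z. Qed.

Lemma unit_diskE z : unit_disk z = (cmod z < 1 : Prop).
Proof. by rewrite /unit_disk /= normE -[1]/(1%:C) ltcR. Qed.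

Lemma cmod_ge0 z : 0 <= cmod z.
Proof. by rewrite -ler0c -normE. Qed.

Lemma cmodM z w : cmod (z * w) = cmod z * cmod w.
Proof. by apply/complexI; rewrite rmorphM /= -!normE normrM. Qed.

Lemma cmodV z : cmod z^-1 = (cmod z)^-1.
Proof. by apply/complexI; rewrite fmorphV /= -!normE normfV. Qed.

Lemma cmodN z : cmod (- z) = cmod z.
Proof. by apply/complexI; rewrite -!normE normrN. Qed.

Lemma cmodD z w : cmod (z + w) <= cmod z + cmod w.
Proof. by rewrite -lecR rmorphD /= -!normE ler_normD. Qed.

Lemma cmodB z w : cmod (z - w) <= cmod z + cmod w.
Proof. by rewrite -(cmodN w) cmodD. Qed.

Lemma cmod_distC z w : cmod (z - w) = cmod (w - z).
Proof. by rewrite -cmodN opprB. Qed.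

Lemma cmod_eq0 z : (cmod z == 0) = (z == 0).
Proof. by rewrite -(inj_eq (@complexI R)) -normE normr_eq0. Qed.

Lemma cmod_gt0 z : (0 < cmod z) = (z != 0).
Proof. by rewrite lt_def cmod_ge0 andbT cmod_eq0. Qed.

Lemma cmod0 : cmod (0 : R[i]) = 0.
Proof. by apply/eqP; rewrite cmod_eq0. Qed.

Lemma cmod_real x : cmod x%:C = `|x|.
Proof. by rewrite cmodE /= expr0n addr0 sqrtr_sqr. Qed.

Lemma cmodi : cmod ('i : R[i]) = 1.
Proof. by rewrite cmodE /= expr0n add0r expr1n sqrtr1. Qed.

Lemma normRe_le z : `|complex.Re z| <= cmod z.
Proof. by rewrite cmodE -sqrtr_sqr ler_wsqrtr// lerDl sqr_ge0. Qed.

Lemma normIm_le z : `|complex.Im z| <= cmod z.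
Proof. by rewrite cmodE -sqrtr_sqr ler_wsqrtr// lerDr sqr_ge0. Qed.

Lemma cmod_le_ReIm z : cmod z <= `|complex.Re z| + `|complex.Im z|.
Proof.
rewrite cmodE -(@ger0_norm _ (`|complex.Re z| + _)) ?addr_ge0//.
rewrite -sqrtr_sqr ler_wsqrtr// sqrrD !real_normK ?num_real//.
by rewrite addrAC lerDl mulrn_wge0// mulr_ge0.
Qed.

Lemma cReB z w : complex.Re (z - w) = complex.Re z - complex.Re w.
Proof. by case: z; case: w. Qed.

Lemma cImB z w : complex.Im (z - w) = complex.Im z - complex.Im w.
Proof. by case: z; case: w. Qed.

Lemma cReD z w : complex.Re (z + w) = complex.Re z + complex.Re w.
Proof. by case: z; case: w. Qed.

Lemma cImD z w : complex.Im (z + w) = complex.Im z + complex.Im w.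
Proof. by case: z; case: w. Qed.

Lemma cReM z w : complex.Re (z * w) =
  complex.Re z * complex.Re w - complex.Im z * complex.Im w.
Proof. by case: z; case: w. Qed.

Lemma cImM z w : complex.Im (z * w) =
  complex.Re z * complex.Im w + complex.Im z * complex.Re w.
Proof. by case: z; case: w. Qed.

Lemma ReIm_eta z : complex.Re z +i* complex.Im z = z.
Proof. by case: z. Qed.

End Modulus.

Section EpsilonDelta.
Variable R : realType.
Notation C := (R[i]^o).

Lemma near_cmodP (z : C) (P : C -> Prop) :
  (\forall w \near z, P w) <->
  exists2 d : R, 0 < d & forall w, cmod (w - z) < d -> P w.
Proof.
split=> [/nbhs_ballP[e /= e0 H]|[d d0 H]].
  have er : e = (complex.Re e)%:C by rewrite RRe_real// ger0_real// ltW.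
  exists (complex.Re e) => [|w wz].
    by rewrite -(ltcR 0) -er.
  by apply: H; rewrite -ball_normE /= distrC normE er ltcR.
apply/nbhs_ballP; exists d%:C => /=; first by rewrite (ltcR 0).
by move=> w; rewrite -ball_normE /= distrC normE ltcR; exact: H.
Qed.

Lemma near_normP (x : R) (P : R -> Prop) :
  (\forall y \near x, P y) <->
  exists2 d : R, 0 < d & forall y, `|y - x| < d -> P y.
Proof.
split=> [/nbhs_ballP[e /= e0 H]|[d d0 H]].
  exists e => // w wz; apply: H; by rewrite -ball_normE /= distrC.
apply/nbhs_ballP; exists d => //= w; rewrite -ball_normE /= distrC; exact: H.
Qed.

Lemma cvg_cmodP (T : Type) (F : set_system T) {FF : Filter F} (f : T -> C) (l : C) :
  f @ F --> l <-> forall e : R, 0 < e -> \forall t \near F, cmod (f t - l) < e.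
Proof.
split=> [/cvgrPdist_lt H e e0|H].
  have := H e%:C; rewrite (ltcR 0) => /(_ e0).
  by apply: filterS => t; rewrite normE ltcR cmod_distC.
apply/cvgrPdist_lt => e e0.
have er : e = (complex.Re e)%:C by rewrite RRe_real// ger0_real// ltW.
have := H (complex.Re e); rewrite -(ltcR 0) -er => /(_ e0).
by apply: filterS => t; rewrite normE er ltcR cmod_distC.
Qed.

Lemma continuous_cmodP (f : C -> C) (z : C) : {for z, continuous f} <->
  forall e : R, 0 < e -> exists2 d : R, 0 < d &
    forall w, cmod (w - z) < d -> cmod (f w - f z) < e.
Proof.
have FF : Filter (nbhs z) by exact: nbhs_filter.
split=> [/(@cvg_cmodP _ _ FF) H e /H /near_cmodP//|H].
by apply/(@cvg_cmodP _ _ FF) => e /H /near_cmodP.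
Qed.

Lemma continuousR_cmodP (f : C -> R) (z : C) : {for z, continuous f} <->
  forall e : R, 0 < e -> exists2 d : R, 0 < d &
    forall w, cmod (w - z) < d -> `|f z - f w| < e.
Proof.
have FF : Filter (nbhs z) by exact: nbhs_filter.
split=> [/(@cvgrPdist_lt _ _ _ _ FF) H e /H /near_cmodP//|H].
by apply/(@cvgrPdist_lt _ _ _ _ FF) => e /H /near_cmodP.
Qed.

Lemma continuous_Re (z : C) : {for z, continuous (@complex.Re R : C -> R)}.
Proof.
apply/continuousR_cmodP => e e0; exists e => // w wz.
by rewrite -cReB (le_lt_trans (normRe_le _))// cmod_distC.
Qed.

Lemma continuous_Im (z : C) : {for z, continuous (@complex.Im R : C -> R)}.
Proof.
apply/continuousR_cmodP => e e0; exists e => // w wz.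
by rewrite -cImB (le_lt_trans (normIm_le _))// cmod_distC.
Qed.

Lemma continuous_cmod (z : C) : {for z, continuous (@cmod R : C -> R)}.
Proof.
apply/continuousR_cmodP => e e0; exists e => // w wz.
apply: le_lt_trans wz.
rewrite ler_norml; apply/andP; split.
  rewrite lerNl opprB lerBlDr; apply: le_trans (cmodD _ _).
  by rewrite subrK.
by rewrite lerBlDr cmod_distC; apply: le_trans (cmodD _ _); rewrite subrK.
Qed.

Lemma continuous_path (z v : C) (s : R) :
  {for s, continuous (fun t : R => z + t%:C * v : C)}.
Proof.
apply/cvg_cmodP => e e0; apply/near_normP.
have v0 : 0 < cmod v + 1 by rewrite ltr_wpDl// cmod_ge0.
exists (e / (cmod v + 1)) => [|t]; first by rewrite divr_gt0.
rewrite ltr_pdivlMr// => ts.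
rewrite opprD addrACA subrr add0r -mulrBl cmodM -rmorphB cmod_real.
by apply: le_lt_trans ts; rewrite ler_wpM2l// lerDl.
Qed.

(** Differentiability in the form of a first-order expansion, which is what
    the bisection argument and the chain rule along a segment consume. *)
Lemma derivable_expansionP (K : numFieldType) (f : K^o -> K^o) (z l : K) :
  is_derive (z : K^o) 1 f l <->
  forall e : K, 0 < e -> \forall k \near (0 : K^o),
    `|f (k + z) - f z - k * l| <= e * `|k|.
Proof.
have aux (e k : K) : k != 0 ->
    (`|l - k^-1 * (f (k + z) - f z)| <= e) =
    (`|f (k + z) - f z - k * l| <= e * `|k|).
  move=> k0; have nk : 0 < `|k| by rewrite normr_gt0.
  rewrite -(ler_pM2r nk) -normrM mulrBl mulrAC mulVf// mul1r.
  by rewrite -normrN opprB (mulrC l).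
split=> [[df dl] e e0|H].
  have /cvgrPdist_le/(_ e e0) : h^-1 *: ((f \o shift z) (h *: 1) - f z)
      @[h --> (0:K^o)^'] --> l by rewrite -dl; exact: df.
  rewrite near_withinE /= => N.
  near=> k; have [->|k0] := eqVneq k 0.
    by rewrite add0r subrr mul0r subrr normr0 mulr0.
  rewrite -aux//.
  have /(_ k0) : k != 0 ->
      `|l - k^-1 *: (f (k *: 1 + z) - f z)| <= e by near: k; exact: N.
  by rewrite /GRing.scale/= mulr1.
have dq : h^-1 *: ((f \o shift z) (h *: 1) - f z) @[h --> (0:K^o)^'] --> l.
  apply/cvgrPdist_le => e e0; rewrite near_withinE /=.
  near=> k => k0; rewrite /GRing.scale/= mulr1 aux//.
  by near: k; exact: H.
split; first by apply/cvg_ex; exists l.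
exact: cvg_lim dq.
Unshelve. all: by end_near.
Qed.

Lemma derive_cmodP (f : C -> C) (z l : C) : is_derive z 1 f l <->
  forall e : R, 0 < e -> exists2 d : R, 0 < d & forall w, cmod (w - z) < d ->
    cmod (f w - f z - (w - z) * l) <= e * cmod (w - z).
Proof.
split=> [/derivable_expansionP H e e0|H].
  have := H e%:C; rewrite (ltcR 0) => /(_ e0)/near_cmodP[d d0 {}H].
  exists d => // w wz; have := H (w - z); rewrite subr0 => /(_ wz).
  by rewrite subrK !normE -rmorphM lecR.
apply/derivable_expansionP => e e0.
have er : e = (complex.Re e)%:C by rewrite RRe_real// ger0_real// ltW.
have := H (complex.Re e); rewrite -(ltcR 0) -er => /(_ e0)[d d0 {}H].
apply/near_cmodP; exists d => // k; rewrite subr0 => kd.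
by have := H (k + z); rewrite addrK er !normE -rmorphM lecR; exact.
Qed.

Lemma derive_normP (f : R -> R) (x l : R) : is_derive (x : R^o) 1 (f : R^o -> R^o) l <->
  forall e : R, 0 < e -> exists2 d : R, 0 < d & forall y, `|y - x| < d ->
    `|f y - f x - (y - x) * l| <= e * `|y - x|.
Proof.
split=> [/derivable_expansionP H e e0|H].
  have /near_normP[d d0 {}H] := H e e0.
  exists d => // w wz; have := H (w - x); rewrite subr0 => /(_ wz).
  by rewrite subrK.
apply/derivable_expansionP => e e0; have [d d0 {}H] := H e e0.
apply/near_normP; exists d => // k; rewrite subr0 => kd.
by have := H (k + x); rewrite addrK; exact.
Qed.

Lemma derive_path (F : C -> C) (z v l : C) (s : R) :
  is_derive (z + s%:C * v) 1 F l ->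
  is_derive (s : R^o) 1 (fun t : R^o => complex.Re (F (z + t%:C * v)) : R^o)
    (complex.Re (v * l)) /\
  is_derive (s : R^o) 1 (fun t : R^o => complex.Im (F (z + t%:C * v)) : R^o)
    (complex.Im (v * l)).
Proof.
move=> /derive_cmodP H.
suff K : forall e : R, 0 < e -> exists2 d : R, 0 < d & forall t, `|t - s| < d ->
    cmod (F (z + t%:C * v) - F (z + s%:C * v) - (t - s)%:C * (v * l)) <=
      e * `|t - s|.
  have ReC (r : R) w : complex.Re (r%:C * w) = r * complex.Re w.
    by rewrite cReM /= mul0r subr0.
  have ImC (r : R) w : complex.Im (r%:C * w) = r * complex.Im w.
    by rewrite cImM /= mul0r addr0.
  split; apply/derive_normP => e /K[d d0 {}K]; exists d => // t /K; apply: le_trans.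
    by apply: le_trans (normRe_le _); rewrite !cReB ReC.
  by apply: le_trans (normIm_le _); rewrite !cImB ImC.
move=> e e0; have v0 : 0 < cmod v + 1 by rewrite ltr_wpDl// cmod_ge0.
have [d d0 {}H] := H (e / (cmod v + 1)) (divr_gt0 e0 v0).
exists (d / (cmod v + 1)) => [|t]; first by rewrite divr_gt0.
rewrite ltr_pdivlMr// => td.
have E : z + t%:C * v - (z + s%:C * v) = (t - s)%:C * v.
  by rewrite opprD addrACA subrr add0r -mulrBl -rmorphB.
have le1 : `|t - s| * cmod v <= `|t - s| * (cmod v + 1).
  by rewrite ler_wpM2l// lerDl.
have /H : cmod (z + t%:C * v - (z + s%:C * v)) < d.
  by rewrite E cmodM cmod_real (le_lt_trans le1).
rewrite E mulrA => /le_trans; apply.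
rewrite cmodM cmod_real mulrAC ler_pdivrMr// -mulrA ler_wpM2l//.
exact: ltW.
Qed.

End EpsilonDelta.

Section ContinuityC.
Variables (R : realType) (T : topologicalType).
Notation C := (R[i]^o).
Implicit Types (f g : T -> C) (x : T).

Lemma continuousC_M f g x : {for x, continuous f} -> {for x, continuous g} ->
  {for x, continuous (fun t => f t * g t : C)}.
Proof. move=> cf cg; exact: (@continuousM R[i] _ f g x cf cg). Qed.

Lemma continuousC_D f g x : {for x, continuous f} -> {for x, continuous g} ->
  {for x, continuous (fun t => f t + g t : C)}.
Proof. move=> cf cg; exact: (@continuousD R[i] C T f g x cf cg). Qed.

Lemma continuousC_B f g x : {for x, continuous f} -> {for x, continuous g} ->
  {for x, continuous (fun t => f t - g t : C)}.
Proof. move=> cf cg; exact: (@continuousB R[i] C T f g x cf cg). Qed.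

Lemma continuousC_V f x : f x != 0 -> {for x, continuous f} ->
  {for x, continuous (fun t => (f t)^-1 : C)}.
Proof. move=> f0 cf; exact: (@continuousV R[i] T f x f0 cf). Qed.

Lemma continuousC_cst (c : C) x : {for x, continuous (fun _ : T => c)}.
Proof. exact: cvg_cst. Qed.

End ContinuityC.

(** * Integrals of complex-valued functions along a segment *)

Section ComplexIntegral.
Variable R : realType.
Notation C := (R[i]^o).
Notation mu := (@lebesgue_measure R).

Lemma continuous_segment_integrable (u : R -> R) (a b : R) :
  {in `[a, b], continuous u} -> mu.-integrable `[a, b] (EFin \o u).
Proof.
move=> cu; apply: continuous_compact_integrable; first exact: segment_compact.
by apply: continuous_in_subspaceT => x; rewrite inE => /cu.
Qed.

Definition cint (a b : R) (g : R -> C) : R[i] :=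
  (\int[mu]_(s in `[a, b]) complex.Re (g s)) +i*
  (\int[mu]_(s in `[a, b]) complex.Im (g s)).

Section segment.
Variables a b : R.
Implicit Types g h : R -> C.

Lemma ReIm_segment_integrable g : {in `[a, b], continuous g} ->
  mu.-integrable `[a, b] (EFin \o (@complex.Re R \o g)) /\
  mu.-integrable `[a, b] (EFin \o (@complex.Im R \o g)).
Proof.
move=> cg; split; apply: continuous_segment_integrable => s /cg cgs.
  exact: (@continuous_comp _ _ _ g (@complex.Re R : C -> R)) (@continuous_Re R (g s)).
exact: (@continuous_comp _ _ _ g (@complex.Im R : C -> R)) (@continuous_Im R (g s)).
Qed.

Lemma cint_linear (k : R[i]) g h :
  {in `[a, b], continuous g} -> {in `[a, b], continuous h} ->
  cint a b (fun s => k * g s + h s) = k * cint a b g + cint a b h.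
Proof.
move=> /ReIm_segment_integrable[rg ig] /ReIm_segment_integrable[rh ih].
have mI : measurable `[a, b] by [].
have Z (r : R) u : mu.-integrable `[a, b] (EFin \o u) ->
    mu.-integrable `[a, b] (EFin \o (fun x => r * u x)).
  by move=> iu; exact: (@integrableZl _ _ R mu _ mI r (EFin \o u) iu).
apply/eqP; rewrite eq_complex cReD cImD cReM cImM /=; apply/andP; split; apply/eqP.
  under eq_Rintegral do rewrite cReD cReM.
  rewrite RintegralD//; last first.
    exact: (@integrableB _ _ R mu _ mI
      (EFin \o (fun x => _ * complex.Re (g x)))
      (EFin \o (fun x => _ * complex.Im (g x))) (Z _ _ rg) (Z _ _ ig)).
  by rewrite RintegralB ?RintegralZl//; exact: Z.
under eq_Rintegral do rewrite cImD cImM.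
rewrite RintegralD//; last first.
  exact: (@integrableD _ _ R mu _ mI
    (EFin \o (fun x => _ * complex.Im (g x)))
    (EFin \o (fun x => _ * complex.Re (g x))) (Z _ _ ig) (Z _ _ rg)).
by rewrite RintegralD ?RintegralZl//; exact: Z.
Qed.

(** The factor 2 comes from treating the real and imaginary parts separately. *)
Lemma cmod_cint_le g (u : R -> R) :
  {in `[a, b], continuous g} -> {in `[a, b], continuous u} ->
  (forall s, s \in `[a, b] -> cmod (g s) <= u s) ->
  cmod (cint a b g) <= 2 * \int[mu]_(s in `[a, b]) u s.
Proof.
move=> /ReIm_segment_integrable[rg ig] /continuous_segment_integrable iu gu.
have mI : measurable `[a, b] by [].
apply: le_trans (cmod_le_ReIm _) _; rewrite mulr2n mulrDl mul1r /=.
apply: lerD.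
  apply: le_trans (le_normr_Rintegral _ rg) _ => //.
  apply: le_Rintegral => //; first exact: (integrable_norm rg).
  by move=> x xab; apply: le_trans (normRe_le _) (gu _ _).
apply: le_trans (le_normr_Rintegral _ ig) _ => //.
apply: le_Rintegral => //; first exact: (integrable_norm ig).
by move=> x xab; apply: le_trans (normIm_le _) (gu _ _).
Qed.

Lemma Rintegral_segment_cst (r : R) : a <= b ->
  \int[mu]_(s in `[a, b]) r = r * (b - a).
Proof.
move=> ab; rewrite Rintegral_cst//= lebesgue_measure_itv /= lte_fin.
by case: ltgtP ab => //= ->; rewrite subrr.
Qed.

Lemma Rintegral_segment_ge_cst (u : R -> R) (m : R) : a <= b ->
  {in `[a, b], continuous u} -> (forall s, s \in `[a, b] -> m <= u s) ->
  m * (b - a) <= \int[mu]_(s in `[a, b]) u s.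
Proof.
move=> ab cu um; rewrite -Rintegral_segment_cst//.
apply: le_Rintegral => //.
  by apply: continuous_segment_integrable => s _; exact: cvg_cst.
exact: continuous_segment_integrable.
Qed.

Lemma cint_split (m : R) g : a <= m <= b -> {in `[a, b], continuous g} ->
  cint a b g = cint a m g + cint m b g.
Proof.
move=> /andP[am mb] /ReIm_segment_integrable[rg ig].
have H u : mu.-integrable `[a, b] (EFin \o u) ->
    \int[mu]_(s in `[a, b]) u s =
    \int[mu]_(s in `[a, m]) u s + \int[mu]_(s in `[m, b]) u s.
  move=> iu; rewrite -(@Rintegral_itv_obnd_cbnd _ m).
    by rewrite -(Rintegral_itvB iu) ?bnd_simp// addrC subrK.
  apply: integrableS iu => //.
  by apply: subset_itv; rewrite bnd_simp.
by rewrite /cint (H _ rg) (H _ ig).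
Qed.

Lemma cint_FTC (F f : R -> C) : a <= b ->
  {in `[a, b], continuous f} ->
  (forall s, s \in `[a, b] ->
    is_derive (s : R^o) 1 (@complex.Re R \o F : R^o -> R^o) (complex.Re (f s)) /\
    is_derive (s : R^o) 1 (@complex.Im R \o F : R^o -> R^o) (complex.Im (f s))) ->
  cint a b f = F b - F a.
Proof.
rewrite le_eqVlt => /predU1P[<- _ _|ab cf dF].
  by rewrite /cint set_itv1 !Rintegral_set1 subrr.
have H (U u : R -> R) : {in `[a, b], continuous u} ->
    (forall s, s \in `[a, b] -> is_derive (s : R^o) 1 (U : R^o -> R^o) (u s)) ->
    \int[mu]_(s in `[a, b]) u s = U b - U a.
  move=> cu dU.
  have cU s : s \in `[a, b] -> {for s, continuous U}.
    move=> /dU[dUs _]; apply: differentiable_continuous.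
    exact/derivable1_diffP.
  rewrite /Rintegral (@continuous_FTC2 _ _ U)//.
  - by apply: continuous_in_subspaceT => x; rewrite inE => /cu.
  - split.
    + by move=> x xab; have [] := dU x (subset_itv_oo_cc xab).
    + by apply: cvg_at_right_filter; apply: cU; rewrite bound_itvE ltW.
    + by apply: cvg_at_left_filter; apply: cU; rewrite bound_itvE ltW.
  - move=> x xab; rewrite derive1E.
    by have [_ ->] := dU x (subset_itv_oo_cc xab).
have Re_c : {in `[a, b], continuous (@complex.Re R \o f)}.
  move=> s /cf cgs.
  exact: (@continuous_comp _ _ _ f (@complex.Re R : C -> R)) (@continuous_Re R (f s)).
have Im_c : {in `[a, b], continuous (@complex.Im R \o f)}.
  move=> s /cf cgs.
  exact: (@continuous_comp _ _ _ f (@complex.Im R : C -> R)) (@continuous_Im R (f s)).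
have := H _ _ Re_c (fun s sab => (dF s sab).1).
have := H _ _ Im_c (fun s sab => (dF s sab).2).
rewrite /cint /= => -> ->.
by apply/eqP; rewrite eq_complex cReB cImB /= !eqxx.
Qed.

End segment.
End ComplexIntegral.

(** * Dyadic bisection of a rectangle *)

Section Bisection.
Variable R : realType.

Lemma nested_segments (v l : nat -> R) : (forall n, 0 <= l n) ->
  (forall n, v n <= v n.+1 /\ v n.+1 + l n.+1 <= v n + l n) ->
  exists X, forall n, v n <= X <= v n + l n.
Proof.
move=> l0 step.
have vn m k : v m <= v (m + k)%N.
  by elim: k => [|k ih]; rewrite ?addn0// addnS (le_trans ih)// (step _).1.
have ln m k : v (m + k)%N + l (m + k)%N <= v m + l m.
  by elim: k => [|k ih]; rewrite ?addn0// addnS (le_trans _ ih)// (step _).2.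
have ub m k : v m <= v k + l k.
  apply: le_trans (vn m k) _; apply: (@le_trans _ _ (v (m + k)%N + l (m + k)%N)).
    by rewrite lerDl.
  by rewrite addnC ln.
exists (sup (range v)) => n; apply/andP; split.
  apply: ub_le_sup; last by exists n.
  by exists (v 0%N + l 0%N) => _ [m _ <-].
by apply: ge_sup; [exists (v 0%N), 0%N|move=> _ [m _ <-]].
Qed.

(** The compactness argument behind Goursat's theorem, stated for an arbitrary
    property P n x y of the dyadic rectangles of size s/2^n by h/2^n with lower
    left corner x, y: it holds for the whole rectangle as soon as it passes
    from the four quarters of a rectangle to the rectangle, and holds for all
    small enough rectangles around each point. *)
Lemma rectangle_bisection (P : nat -> R -> R -> Prop) (s h x0 y0 : R) :
  0 <= s -> 0 <= h ->
  (forall n x y, P n.+1 x y -> P n.+1 (x + s / 2 ^+ n.+1) y ->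
     P n.+1 x (y + h / 2 ^+ n.+1) ->
     P n.+1 (x + s / 2 ^+ n.+1) (y + h / 2 ^+ n.+1) -> P n x y) ->
  (forall X Y, x0 <= X <= x0 + s -> y0 <= Y <= y0 + h ->
     exists N, forall n x y, (N <= n)%N ->
       x0 <= x -> x + s / 2 ^+ n <= x0 + s ->
       y0 <= y -> y + h / 2 ^+ n <= y0 + h ->
       x <= X <= x + s / 2 ^+ n -> y <= Y <= y + h / 2 ^+ n -> P n x y) ->
  P 0%N x0 y0.
Proof.
move=> s0 h0 quarter loc; apply: contrapT => nP.
have pick (q : nat * (R * R)) : exists b : bool * bool,
    ~ P q.1 q.2.1 q.2.2 ->
    ~ P q.1.+1 (q.2.1 + b.1%:R * (s / 2 ^+ q.1.+1))
               (q.2.2 + b.2%:R * (h / 2 ^+ q.1.+1)).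
  case: q => n [x y] /=.
  have [|nPn] := pselect (P n x y); first by exists (false, false).
  apply: contrapT => /forallNP none.
  have all (b1 b2 : bool) : P n.+1 (x + b1%:R * (s / 2 ^+ n.+1)) (y + b2%:R * (h / 2 ^+ n.+1)).
    by apply: contrapT => nb; exact: (none (b1, b2) (fun=> nb)).
  apply: nPn; apply: quarter.
  - by have := all false false; rewrite !mul0r !addr0.
  - by have := all true false; rewrite !mul0r !addr0 mul1r.
  - by have := all false true; rewrite !mul0r !addr0 mul1r.
  - by have := all true true; rewrite !mul1r.
have [g gP] := choice pick.
pose u := fix u n := if n is m.+1 then
  ((u m).1 + (g (m, u m)).1%:R * (s / 2 ^+ m.+1),
   (u m).2 + (g (m, u m)).2%:R * (h / 2 ^+ m.+1)) else (x0, y0).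
have nPu n : ~ P n (u n).1 (u n).2 by elim: n => // n ih; exact: (gP (n, u n)).
have half (r : R) n : r / 2 ^+ n = r / 2 ^+ n.+1 + r / 2 ^+ n.+1.
  by rewrite exprS; field; rewrite expf_neq0.
have small (b : bool) (r : R) n : 0 <= r ->
    0 <= b%:R * (r / 2 ^+ n.+1) /\
    b%:R * (r / 2 ^+ n.+1) + r / 2 ^+ n.+1 <= r / 2 ^+ n.
  move=> r0; have ? : 0 <= r / 2 ^+ n.+1 by rewrite divr_ge0// exprn_ge0.
  by rewrite (half r n); case: b; rewrite ?mul1r ?mul0r; split => //; lra.
have step1 n : (u n).1 <= (u n.+1).1 /\
    (u n.+1).1 + s / 2 ^+ n.+1 <= (u n).1 + s / 2 ^+ n.
  by have [? ?] := small (g (n, u n)).1 s n s0; rewrite /=; split; lra.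
have step2 n : (u n).2 <= (u n.+1).2 /\
    (u n.+1).2 + h / 2 ^+ n.+1 <= (u n).2 + h / 2 ^+ n.
  by have [? ?] := small (g (n, u n)).2 h n h0; rewrite /=; split; lra.
have [X uX] := @nested_segments (fun n => (u n).1) (fun n => s / 2 ^+ n)
  (fun n => divr_ge0 s0 (exprn_ge0 n (ler0n R 2))) step1.
have [Y uY] := @nested_segments (fun n => (u n).2) (fun n => h / 2 ^+ n)
  (fun n => divr_ge0 h0 (exprn_ge0 n (ler0n R 2))) step2.
have in1 n : x0 <= (u n).1 /\ (u n).1 + s / 2 ^+ n <= x0 + s.
  elim: n => [|n [ih1 ih2]]; first by rewrite /= expr0 divr1.
  by have [? ?] := step1 n; split; [apply: le_trans ih1 _|apply: le_trans ih2].
have in2 n : y0 <= (u n).2 /\ (u n).2 + h / 2 ^+ n <= y0 + h.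
  elim: n => [|n [ih1 ih2]]; first by rewrite /= expr0 divr1.
  by have [? ?] := step2 n; split; [apply: le_trans ih1 _|apply: le_trans ih2].
have := uX 0%N; have := uY 0%N; rewrite /= expr0 !divr1 => Y0 X0.
have [N HN] := loc X Y X0 Y0.
by apply: (nPu N); apply: HN => //; [exact: (in1 N).1|exact: (in1 N).2|
  exact: (in2 N).1|exact: (in2 N).2].
Qed.

Lemma dyadic_small (d r : R) : 0 < d -> exists N, forall n, (N <= n)%N -> r / 2 ^+ n < d.
Proof.
move=> d0; exists (Num.truncn (`|r| / d)).+1 => n Nn.
rewrite ltr_pdivrMr ?exprn_gt0// mulrC -ltr_pdivrMr//.
apply: (@le_lt_trans _ _ (`|r| / d)).
  by rewrite ler_pM2r ?invr_gt0// ler_norm.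
apply: lt_le_trans (truncnS_gt _) _.
apply: (@le_trans _ _ n%:R); first by rewrite ler_nat.
by rewrite -natrX ler_nat ltnW// ltn_expl.
Qed.

End Bisection.

(** * Integrals along the boundary of a rectangle *)

Section Contour.
Variable R : realType.
Notation C := (R[i]^o).

Definition rectangle (a b c d : R) : set R[i] :=
  [set z | a <= complex.Re z <= b /\ c <= complex.Im z <= d].

Definition edges (a b c d : R) : set R[i] :=
  [set z | (a <= complex.Re z <= b /\ (complex.Im z = c \/ complex.Im z = d)) \/
           (c <= complex.Im z <= d /\ (complex.Re z = a \/ complex.Re z = b))].

(** The integral of f(z) dz along the boundary of the rectangle
    [a, b] x [c, d], run counterclockwise. *)
Definition contour (f : C -> C) (a b c d : R) : R[i] :=
  cint a b (fun s => f (s +i* c)) - cint a b (fun s => f (s +i* d)) +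
  'i * (cint c d (fun s => f (b +i* s)) - cint c d (fun s => f (a +i* s))).

Lemma edges_rectangle a b c d : a <= b -> c <= d ->
  edges a b c d `<=` rectangle a b c d.
Proof.
move=> ab cd z; rewrite /edges /rectangle /=.
move=> [[zx [->|->]]|[zy [->|->]]]; split => //; rewrite ?lexx ?ab ?cd//.
Qed.

Lemma horizontalE (s c : R) : s +i* c = 0 +i* c + s%:C * 1.
Proof. by rewrite mulr1; apply/eqP; rewrite eq_complex /= add0r addr0 !eqxx. Qed.

Lemma verticalE (s b : R) : b +i* s = b +i* 0 + s%:C * 'i.
Proof.
by apply/eqP; rewrite eq_complex /= !mul0r !mulr0 mulr1 subr0 !addr0 add0r !eqxx.
Qed.

Lemma continuous_horizontal (T : topologicalType) (f : C -> T) (c s : R) :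
  {for (s +i* c : C), continuous f} ->
  {for s, continuous (fun t : R => f (t +i* c))}.
Proof.
rewrite horizontalE.
rewrite (_ : (fun t : R => f (t +i* c)) = f \o (fun t : R => 0 +i* c + t%:C * 1)).
  move=> cf; apply: continuous_comp (cf); exact: (@continuous_path R).
by apply/funext => t /=; rewrite horizontalE.
Qed.

Lemma continuous_vertical (T : topologicalType) (f : C -> T) (b s : R) :
  {for (b +i* s : C), continuous f} ->
  {for s, continuous (fun t : R => f (b +i* t))}.
Proof.
rewrite verticalE.
rewrite (_ : (fun t : R => f (b +i* t)) = f \o (fun t : R => b +i* 0 + t%:C * 'i)).
  move=> cf; apply: continuous_comp (cf); exact: (@continuous_path R).
by apply/funext => t /=; rewrite verticalE.
Qed.

Section fixed_rectangle.
Variables a b c d : R.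
Hypotheses (ab : a <= b) (cd : c <= d).

Lemma continuous_edges (T : topologicalType) (f : C -> T) :
  (forall z, edges a b c d z -> {for (z : C), continuous f}) ->
  [/\ {in `[a, b], continuous (fun s => f (s +i* c))},
      {in `[a, b], continuous (fun s => f (s +i* d))},
      {in `[c, d], continuous (fun s => f (b +i* s))} &
      {in `[c, d], continuous (fun s => f (a +i* s))}].
Proof.
move=> cf; split => s; rewrite in_itv /= => sab.
- by apply: continuous_horizontal; apply: cf; left; split => //; left.
- by apply: continuous_horizontal; apply: cf; left; split => //; right.
- by apply: continuous_vertical; apply: cf; right; split => //; right.
- by apply: continuous_vertical; apply: cf; right; split => //; left.
Qed.

Lemma contour_linear (k : R[i]) (f g : C -> C) :
  (forall z, edges a b c d z -> {for z, continuous f}) ->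
  (forall z, edges a b c d z -> {for z, continuous g}) ->
  contour (fun z => k * f z + g z) a b c d =
    k * contour f a b c d + contour g a b c d.
Proof.
move=> /continuous_edges[f1 f2 f3 f4] /continuous_edges[g1 g2 g3 g4].
rewrite /contour (cint_linear k f1 g1) (cint_linear k f2 g2).
rewrite (cint_linear k f3 g3) (cint_linear k f4 g4).
have E (i x1 x2 x3 x4 y1 y2 y3 y4 : R[i]) :
  k * x1 + y1 - (k * x2 + y2) + i * (k * x3 + y3 - (k * x4 + y4)) =
  k * (x1 - x2 + i * (x3 - x4)) + (y1 - y2 + i * (y3 - y4)) by ring.
exact: E.
Qed.

Lemma contourB (f g : C -> C) :
  (forall z, edges a b c d z -> {for (z : C), continuous f}) ->
  (forall z, edges a b c d z -> {for (z : C), continuous g}) ->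
  contour (fun z => f z - g z) a b c d = contour f a b c d - contour g a b c d.
Proof.
move=> cf cg; have := contour_linear (-1) cg cf.
rewrite mulN1r addrC => <-; congr (contour _ a b c d).
by apply/funext => z; rewrite mulN1r addrC.
Qed.

Lemma cmod_contour_le (f : C -> C) (u1 u2 u3 u4 : R -> R) :
  (forall z, edges a b c d z -> {for z, continuous f}) ->
  {in `[a, b], continuous u1} -> {in `[a, b], continuous u2} ->
  {in `[c, d], continuous u3} -> {in `[c, d], continuous u4} ->
  (forall s, s \in `[a, b] -> cmod (f (s +i* c)) <= u1 s) ->
  (forall s, s \in `[a, b] -> cmod (f (s +i* d)) <= u2 s) ->
  (forall s, s \in `[c, d] -> cmod (f (b +i* s)) <= u3 s) ->
  (forall s, s \in `[c, d] -> cmod (f (a +i* s)) <= u4 s) ->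
  cmod (contour f a b c d) <= 2 *
    (\int[@lebesgue_measure R]_(s in `[a, b]) u1 s +
     \int[@lebesgue_measure R]_(s in `[a, b]) u2 s +
     \int[@lebesgue_measure R]_(s in `[c, d]) u3 s +
     \int[@lebesgue_measure R]_(s in `[c, d]) u4 s).
Proof.
move=> /continuous_edges[f1 f2 f3 f4] c1 c2 c3 c4 fu1 fu2 fu3 fu4.
rewrite /contour; apply: le_trans (cmodD _ _) _.
rewrite cmodM cmodi mul1r -(addrA (_ + _)) mulrDr; apply: lerD.
  apply: le_trans (cmodB _ _) _; rewrite mulrDr.
  by apply: lerD; [exact: (cmod_cint_le f1)|exact: (cmod_cint_le f2)].
apply: le_trans (cmodB _ _) _; rewrite mulrDr.
by apply: lerD; [exact: (cmod_cint_le f3)|exact: (cmod_cint_le f4)].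
Qed.

Lemma cmod_contour_le_cst (f : C -> C) (M : R) :
  (forall z, edges a b c d z -> {for z, continuous f}) ->
  (forall z, edges a b c d z -> cmod (f z) <= M) ->
  cmod (contour f a b c d) <= 4 * M * ((b - a) + (d - c)).
Proof.
move=> cf fM.
have cM (x y : R) : {in `[x, y], continuous (cst M : R -> R)}.
  by move=> s _; exact: cvg_cst.
apply: le_trans (@cmod_contour_le f (cst M) (cst M) (cst M) (cst M) cf
  (cM _ _) (cM _ _) (cM _ _) (cM _ _) _ _ _ _) _ => [s|s|s|s|].
- by rewrite in_itv /= => sab; apply: fM; left; split => //; left.
- by rewrite in_itv /= => sab; apply: fM; left; split => //; right.
- by rewrite in_itv /= => sab; apply: fM; right; split => //; right.
- by rewrite in_itv /= => sab; apply: fM; right; split => //; left.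
- by rewrite /cst !Rintegral_segment_cst//; lra.
Qed.

Lemma contour_split_Re (f : C -> C) (m : R) : a <= m <= b ->
  {in `[a, b], continuous (fun s => f (s +i* c))} ->
  {in `[a, b], continuous (fun s => f (s +i* d))} ->
  contour f a b c d = contour f a m c d + contour f m b c d.
Proof.
move=> amb f1 f2; rewrite /contour (cint_split amb f1) (cint_split amb f2).
have E (i x1 x2 x3 x4 y1 y2 y3 : R[i]) :
  x1 + x2 - (x3 + x4) + i * (y2 - y1) =
  x1 - x3 + i * (y3 - y1) + (x2 - x4 + i * (y2 - y3)) by ring.
exact: E.
Qed.

Lemma contour_split_Im (f : C -> C) (m : R) : c <= m <= d ->
  {in `[c, d], continuous (fun s => f (a +i* s))} ->
  {in `[c, d], continuous (fun s => f (b +i* s))} ->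
  contour f a b c d = contour f a b c m + contour f a b m d.
Proof.
move=> cmd f1 f2; rewrite /contour (cint_split cmd f1) (cint_split cmd f2).
have E (i x1 x2 x3 y1 y2 y3 y4 : R[i]) :
  x1 - x2 + i * (y1 + y2 - (y3 + y4)) =
  x1 - x3 + i * (y1 - y3) + (x3 - x2 + i * (y2 - y4)) by ring.
exact: E.
Qed.

(** Along each side the integral is the increment of the primitive, and the
    increments cancel around a closed path. *)
Lemma contour_derivative (F f : C -> C) :
  (forall z, edges a b c d z -> {for z, continuous f}) ->
  (forall z, edges a b c d z -> is_derive (z : C) 1 F (f z)) ->
  contour f a b c d = 0.
Proof.
move=> /continuous_edges[f1 f2 f3 f4] dF.
have H y : (forall s, s \in `[a, b] -> is_derive (s +i* y : C) 1 F (f (s +i* y))) ->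
    {in `[a, b], continuous (fun s => f (s +i* y))} ->
    cint a b (fun s => f (s +i* y)) = F (b +i* y) - F (a +i* y).
  move=> dFy cfy.
  apply: (cint_FTC (F := fun s => F (s +i* y)) ab cfy) => s /dFy.
  rewrite {1}horizontalE => /derive_path; rewrite mul1r.
  have -> : (fun t : R => F (t +i* y)) = (fun t => F (0 +i* y + t%:C * 1)).
    by apply/funext => t; rewrite -horizontalE.
  by [].
have V x : (forall s, s \in `[c, d] -> is_derive (x +i* s : C) 1 F (f (x +i* s))) ->
    {in `[c, d], continuous (fun s => f (x +i* s))} ->
    'i * cint c d (fun s => f (x +i* s)) = F (x +i* d) - F (x +i* c).
  move=> dFx cfx.
  have c0 : {in `[c, d], continuous (fun=> 0 : C)} by move=> s _; exact: cvg_cst.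
  have := cint_linear 'i cfx c0.
  have -> : cint c d (fun=> 0 : C) = 0.
    apply/eqP; rewrite eq_complex /= /Rintegral !integral0 /=.
    by rewrite eqxx.
  rewrite addr0 => <-.
  have ci : {in `[c, d], continuous (fun s => 'i * f (x +i* s) + 0 : C)}.
    move=> s scd.
    exact: (continuousC_D (continuousC_M (@continuousC_cst R _ 'i s) (cfx s scd))
      (@continuousC_cst R _ 0 s)).
  apply: (cint_FTC (F := fun s => F (x +i* s)) cd ci) => s /dFx; rewrite addr0.
  rewrite {1}verticalE => /derive_path.
  have -> : (fun t : R => F (x +i* t)) = (fun t => F (x +i* 0 + t%:C * 'i)).
    by apply/funext => t; rewrite -verticalE.
  by [].
have D1 s : s \in `[a, b] -> is_derive (s +i* c : C) 1 F (f (s +i* c)).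
  by rewrite in_itv /= => sab; apply: dF; left; split => //; left.
have D2 s : s \in `[a, b] -> is_derive (s +i* d : C) 1 F (f (s +i* d)).
  by rewrite in_itv /= => sab; apply: dF; left; split => //; right.
have D3 s : s \in `[c, d] -> is_derive (b +i* s : C) 1 F (f (b +i* s)).
  by rewrite in_itv /= => scd; apply: dF; right; split => //; right.
have D4 s : s \in `[c, d] -> is_derive (a +i* s : C) 1 F (f (a +i* s)).
  by rewrite in_itv /= => scd; apply: dF; right; split => //; left.
have := H c D1 f1; have := H d D2 f2; have := V b D3 f3; have := V a D4 f4.
rewrite /contour mulrBr => -> -> -> ->.
by move: (F _) (F _) (F _) (F _) => x1 x2 x3 x4; ring.
Qed.

End fixed_rectangle.
End Contour.

(** * Goursat's theorem *)

Section Goursat.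
Variable R : realType.
Notation C := (R[i]^o).
Implicit Types f g : C -> C.

Lemma derivable_continuousC f (z : C) : derivable f z 1 -> {for z, continuous f}.
Proof. by move=> /derivable1_diffP /differentiable_continuous. Qed.

Lemma is_derive_derive1 f (z : C) : derivable f z 1 -> is_derive z 1 f (derive1 f z).
Proof. by move=> df; apply: DeriveDef; rewrite ?derive1E. Qed.

Lemma is_derive_affine_primitive (A l z0 z : C) :
  is_derive z 1 (fun w : C => (w - z0) * A + (w - z0) ^+ 2 * (l / 2) : C)
    (A + (z - z0) * l).
Proof.
apply/derive_cmodP => e e0; pose r := cmod (l / 2) + 1.
have r0 : 0 < r by rewrite ltr_wpDl// cmod_ge0.
exists (e / r) => [|w]; first by rewrite divr_gt0.
rewrite ltr_pdivlMr// => wz.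
have -> : (w - z0) * A + (w - z0) ^+ 2 * (l / 2) -
    ((z - z0) * A + (z - z0) ^+ 2 * (l / 2)) - (w - z) * (A + (z - z0) * l) =
    (w - z) * ((w - z) * (l / 2)) by field.
rewrite (cmodM (w - z)) (cmodM _ (l / 2)) mulrC ler_wpM2r ?cmod_ge0//.
by apply: le_trans (ltW wz); rewrite ler_wpM2l ?cmod_ge0// /r lerDl.
Qed.

Lemma continuous_affineC (A l z0 z : C) :
  {for z, continuous (fun w : C => A + (w - z0) * l : C)}.
Proof.
apply/continuous_cmodP => e e0; pose r := cmod l + 1.
have r0 : 0 < r by rewrite ltr_wpDl// cmod_ge0.
exists (e / r) => [|w]; first by rewrite divr_gt0.
rewrite ltr_pdivlMr// => wz.
have -> : A + (w - z0) * l - (A + (z - z0) * l) = (w - z) * l by ring.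
by rewrite cmodM; apply: le_lt_trans wz; rewrite ler_wpM2l ?cmod_ge0// /r lerDl.
Qed.

Lemma contour_affine (A l z0 : C) a b c d : a <= b -> c <= d ->
  contour (fun z => A + (z - z0) * l) a b c d = 0.
Proof.
move=> ab cd.
exact: (contour_derivative ab cd (fun z _ => @continuous_affineC A l z0 z)
  (fun z _ => @is_derive_affine_primitive A l z0 z)).
Qed.

Lemma contour_quarters f (x y s h : R) : 0 <= s -> 0 <= h ->
  (forall z, rectangle x (x + s + s) y (y + h + h) z -> {for (z : C), continuous f}) ->
  contour f x (x + s + s) y (y + h + h) =
    contour f x (x + s) y (y + h) + contour f x (x + s) (y + h) (y + h + h) +
    (contour f (x + s) (x + s + s) y (y + h) +
     contour f (x + s) (x + s + s) (y + h) (y + h + h)).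
Proof.
move=> s0 h0 cf.
have x1 : x <= x + s by rewrite lerDl.
have x2 : x + s <= x + s + s by rewrite lerDl.
have y1 : y <= y + h by rewrite lerDl.
have y2 : y + h <= y + h + h by rewrite lerDl.
have hor v : y <= v <= y + h + h ->
    {in `[x, x + s + s], continuous (fun t => f (t +i* v))}.
  by move=> hv t; rewrite in_itv /= => ht; apply: continuous_horizontal; exact: cf.
have ver u : x <= u <= x + s + s ->
    {in `[y, y + h + h], continuous (fun t => f (u +i* t))}.
  by move=> hu t; rewrite in_itv /= => ht; apply: continuous_vertical; exact: cf.
rewrite (@contour_split_Re _ _ _ _ _ f (x + s)) ?x1//; last 2 first.
- by apply: hor; rewrite lexx (le_trans y1).
- by apply: hor; rewrite lexx (le_trans y1).
rewrite (@contour_split_Im _ x (x + s) _ _ f (y + h)) ?y1//; last 2 first.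
- by apply: ver; rewrite lexx (le_trans x1).
- by apply: ver; rewrite x1.
rewrite (@contour_split_Im _ (x + s) (x + s + s) _ _ f (y + h)) ?y1//.
- by apply: ver; rewrite x1.
- by apply: ver; rewrite lexx (le_trans x1).
Qed.

Lemma dist_segment (x r u v : R) :
  x <= u <= x + r -> x <= v <= x + r -> `|u - v| <= r.
Proof.
move=> /andP[? ?] /andP[? ?]; rewrite ler_norml; apply/andP; split; lra.
Qed.

(** Around a point z0, f is an affine function up to o(|z - z0|), and affine
    functions have primitives; so the contour of a small rectangle is negligible
    before its area. Bisection turns this into a bound of the contour of the
    whole rectangle by an arbitrary multiple of its area. *)
Lemma goursat f a b c d : a <= b -> c <= d ->
  (forall z, rectangle a b c d z -> derivable f z 1) -> contour f a b c d = 0.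
Proof.
move=> ab cd df.
have cf z : rectangle a b c d z -> {for (z : C), continuous f}.
  by move=> /df; exact: derivable_continuousC.
pose s := b - a; pose h := d - c.
have s0 : 0 <= s by rewrite subr_ge0.
have h0 : 0 <= h by rewrite subr_ge0.
have pow0 n : 0 < 2 ^+ n :> R by rewrite exprn_gt0.
apply/eqP; rewrite -cmod_eq0 eq_le cmod_ge0 andbT; apply/ler_addgt0Pl => e e0.
rewrite addr0.
(* A rectangle of the n-th generation has 1 / 4 ^+ n of the area, so that the
   bounds of the four quarters add up to that of the rectangle. *)
pose P n x y := a <= x -> x + s / 2 ^+ n <= b -> c <= y -> y + h / 2 ^+ n <= d ->
  cmod (contour f x (x + s / 2 ^+ n) y (y + h / 2 ^+ n)) <= e / 4 ^+ n.
suff : P 0%N a c.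
  by rewrite /P !expr0 !divr1 /s /h !(addrC a) !(addrC c) !subrK; exact.
apply: (@rectangle_bisection R P s h a c) => //.
- move=> n x y P1 P2 P3 P4 ax xb cy yd.
  have half r : r / 2 ^+ n = r / 2 ^+ n.+1 + r / 2 ^+ n.+1 :> R.
    by rewrite exprS; field; rewrite expf_neq0.
  have s'0 : 0 <= s / 2 ^+ n.+1 by rewrite divr_ge0// ltW.
  have h'0 : 0 <= h / 2 ^+ n.+1 by rewrite divr_ge0// ltW.
  have e4 : e / 4 ^+ n = e / 4 ^+ n.+1 + e / 4 ^+ n.+1 + (e / 4 ^+ n.+1 + e / 4 ^+ n.+1).
    by rewrite exprS; field; rewrite expf_neq0.
  have xE : x + s / 2 ^+ n = x + s / 2 ^+ n.+1 + s / 2 ^+ n.+1 by rewrite half addrA.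
  have yE : y + h / 2 ^+ n = y + h / 2 ^+ n.+1 + h / 2 ^+ n.+1 by rewrite half addrA.
  rewrite e4 xE yE contour_quarters//; last first.
    move=> z; rewrite -xE -yE => -[/andP[zx1 zx2] /andP[zy1 zy2]]; apply: cf.
    by split; rewrite ?(le_trans ax zx1) ?(le_trans zx2 xb) ?(le_trans cy zy1)
      ?(le_trans zy2 yd).
  have ax' : a <= x + s / 2 ^+ n.+1 by rewrite (le_trans ax)// lerDl.
  have cy' : c <= y + h / 2 ^+ n.+1 by rewrite (le_trans cy)// lerDl.
  have xb' : x + s / 2 ^+ n.+1 <= b by rewrite (le_trans _ xb)// xE lerDl.
  have yd' : y + h / 2 ^+ n.+1 <= d by rewrite (le_trans _ yd)// yE lerDl.
  rewrite xE in xb; rewrite yE in yd.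
  apply: le_trans (cmodD _ _) _; apply: lerD.
    by apply: le_trans (cmodD _ _) _; apply: lerD; [exact: P1|exact: P3].
  by apply: le_trans (cmodD _ _) _; apply: lerD; [exact: P2|exact: P4].
- move=> X Y; rewrite /s /h !(addrC a) !(addrC c) !subrK => aX cY.
  pose z0 : C := X +i* Y.
  have /is_derive_derive1/derive_cmodP dz0 : derivable f z0 1 by exact: df.
  (* 4 (s + h) ^+ 2 is the constant that cmod_contour_le_cst produces for an
     integrand bounded by the distance to z0; adding 1 makes it positive. *)
  pose K := 4 * (s + h) ^+ 2 + 1.
  have K0 : 0 < K by rewrite ltr_wpDl// mulr_ge0// sqr_ge0.
  have [r r0 Hr] := dz0 (e / K) (divr_gt0 e0 K0).
  have [N HN] := dyadic_small (s + h) r0.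
  exists N => n x y Nn _ _ _ _ Xx Yy ax xb cy yd.
  have s'0 : 0 <= s / 2 ^+ n by rewrite divr_ge0// ltW.
  have h'0 : 0 <= h / 2 ^+ n by rewrite divr_ge0// ltW.
  have sh : s / 2 ^+ n + h / 2 ^+ n < r by rewrite -mulrDl; exact: HN.
  pose A := fun z : C => f z0 + (z - z0) * derive1 f z0.
  have xs : x <= x + s / 2 ^+ n by rewrite lerDl.
  have yh : y <= y + h / 2 ^+ n by rewrite lerDl.
  have sub z : edges x (x + s / 2 ^+ n) y (y + h / 2 ^+ n) z ->
      rectangle a b c d z /\ cmod (z - z0) <= s / 2 ^+ n + h / 2 ^+ n.
    move=> /(edges_rectangle xs yh)[zx zy]; split.
      move: zx zy => /andP[zx1 zx2] /andP[zy1 zy2].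
      by split; rewrite ?(le_trans ax zx1) ?(le_trans zx2 xb) ?(le_trans cy zy1)
        ?(le_trans zy2 yd).
    apply: le_trans (cmod_le_ReIm _) _; rewrite cReB cImB.
    by apply: lerD; [exact: dist_segment zx Xx|exact: dist_segment zy Yy].
  have cA z : {for z, continuous A}.
    exact: continuous_affineC.
  have cfe z : edges x (x + s / 2 ^+ n) y (y + h / 2 ^+ n) z ->
      {for (z : C), continuous f} by move=> /sub[/cf].
  have <- : contour (fun z => f z - A z) x (x + s / 2 ^+ n) y (y + h / 2 ^+ n) =
      contour f x (x + s / 2 ^+ n) y (y + h / 2 ^+ n).
    by rewrite (@contourB _ _ _ _ _ f A cfe (fun z _ => cA z)) (contour_affine _ _ _ xs yh) subr0.
  apply: le_trans (cmod_contour_le_cst xs yh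
    (M := e / K * (s / 2 ^+ n + h / 2 ^+ n)) _ _) _.
  + by move=> z ez; exact: (continuousC_B (cfe z ez) (cA z)).
  + move=> z ez; have [_ zz0] := sub z ez.
    have -> : f z - A z = f z - f z0 - (z - z0) * derive1 f z0.
      by rewrite /A opprD addrA.
    apply: le_trans (Hr _ (le_lt_trans zz0 sh)) _.
    by rewrite ler_wpM2l// divr_ge0// ltW.
  + rewrite (addrC x) addrK (addrC y) addrK -mulrDl.
    have -> : 4 ^+ n = 2 ^+ n * 2 ^+ n :> R by rewrite -exprMn -natrM.
    have -> : 4 * (e / K * ((s + h) / 2 ^+ n)) * ((s + h) / 2 ^+ n) =
        e / (2 ^+ n * 2 ^+ n) * ((4 * (s + h) ^+ 2) / K).
      by field; rewrite !gt_eqF.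
    rewrite ler_piMr//; first by rewrite divr_ge0 ?mulr_ge0// ltW.
    by rewrite ler_pdivrMr// mul1r lerDl.
Qed.
End Goursat.

(** * Cauchy's formula for the derivative *)

Section CauchyFormula.
Variable R : realType.
Notation C := (R[i]^o).
Implicit Types f g : C -> C.

Lemma is_derive_div (K : numFieldType) (g h : K^o -> K^o) (z dg dh : K^o) :
  h z != 0 -> is_derive z 1 g dg -> is_derive z 1 h dh ->
  is_derive z 1 (fun u : K^o => g u / h u : K^o) (dg / h z - g z * dh / h z ^+ 2).
Proof.
move=> hz dgz dhz.
have d2 : is_derive z 1 (fun u : K^o => (h u)^-1 : K^o) (- (h z) ^- 2 * dh).
  apply: DeriveDef; first by apply: derivableV => //; case: dhz.
  by rewrite deriveV//; case: dhz => _ ->.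
have := @is_deriveM _ _ _ _ _ _ _ _ dgz d2.
move=> /is_derive_eq; apply.
by rewrite /GRing.scale /=; field.
Qed.

Lemma is_derive_quotient (K : numFieldType) (g : K^o -> K^o) (w z dg : K^o) :
  z != w -> is_derive z 1 g dg ->
  is_derive z 1 (fun u : K^o => g u / (u - w) : K^o)
    (dg / (z - w) - g z / (z - w) / (z - w)).
Proof.
rewrite -subr_eq0 => zw dgz.
have dh : is_derive z 1 (fun u : K^o => u - w : K^o) 1.
  by apply: is_derive_eq; rewrite subr0.
have := @is_derive_div K g (fun u : K^o => u - w) z dg 1 zw dgz dh.
by move=> /is_derive_eq; apply; field.
Qed.

Lemma derivable_quotient f (w z : C) : z != w -> derivable f z 1 ->
  derivable (fun u : C => f u / (u - w) : C) z 1.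
Proof.
move=> zw /is_derive_derive1 df.
by have [] := @is_derive_quotient R[i] f w z _ zw df.
Qed.

Lemma is_derive_derive1E f (z l : C) : is_derive z 1 f l -> derive1 f z = l.
Proof. by move=> [_ <-]; rewrite derive1E. Qed.

Lemma min5_gt0 (u1 u2 u3 u4 u5 : R) : 0 < u1 -> 0 < u2 -> 0 < u3 -> 0 < u4 ->
  0 < u5 -> exists2 r, 0 < r & [/\ r <= u1, r <= u2, r <= u3, r <= u4 & r <= u5].
Proof.
move=> *; exists (Num.min u1 (Num.min u2 (Num.min u3 (Num.min u4 u5)))).
  by rewrite !lt_min; apply/and5P; split.
by split; rewrite !ge_min lexx ?orbT.
Qed.

(** A contour ignores an isolated point at which the integrand is o(1/|z - w|):
    cutting along the sides of a small square around w leaves four rectangles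
    covered by Goursat's theorem, and the contour of the square tends to 0. *)
Lemma contour_punctured f (w : C) a b c d :
  a < complex.Re w < b -> c < complex.Im w < d ->
  (forall z, rectangle a b c d z -> z != w -> derivable f z 1) ->
  (forall e, 0 < e -> exists2 r, 0 < r & forall z, z != w -> cmod (z - w) < r ->
     cmod (f z) * cmod (z - w) <= e) ->
  contour f a b c d = 0.
Proof.
move=> /andP[ax xb] /andP[cy yd] df fo.
apply/eqP; rewrite -cmod_eq0 eq_le cmod_ge0 andbT; apply/ler_addgt0Pl => e e0.
rewrite addr0.
have [r0 r00 Hr] := fo (e / 16) (divr_gt0 e0 (ltr0n R 16)).
move: (complex.Re w) (complex.Im w) ax xb cy yd (ReIm_eta w) => x y ax xb cy yd wE.
have [r rp [r1 r2 r3 r4 r5]] := @min5_gt0 (x - a) (b - x) (y - c) (d - y) (r0 / 3)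
  ltac:(lra) ltac:(lra) ltac:(lra) ltac:(lra) ltac:(lra).
have a1 : a <= x - r by lra.
have a2 : x - r <= x + r by lra.
have a3 : x + r <= b by lra.
have c1 : c <= y - r by lra.
have c2 : y - r <= y + r by lra.
have c3 : y + r <= d by lra.
have rr0 : r + r < r0 by lra.
have cf z : rectangle a b c d z -> z != w -> {for (z : C), continuous f}.
  by move=> rz zw; apply: derivable_continuousC; exact: df.
have hor v : c <= v <= d -> v != y -> {in `[a, b], continuous (fun t => f (t +i* v))}.
  move=> hv vy t; rewrite in_itv /= => ht; apply: continuous_horizontal.
  apply: cf => //; apply: contra_neq vy => tv.
  by have := congr1 (@complex.Im R) tv; rewrite -wE.
have ver u : a <= u <= b -> u != x -> {in `[c, d], continuous (fun t => f (u +i* t))}.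
  move=> hu ux t; rewrite in_itv /= => ht; apply: continuous_vertical.
  apply: cf => //; apply: contra_neq ux => tv.
  by have := congr1 (@complex.Re R) tv; rewrite -wE.
have cd : c <= d by lra.
have hc : {in `[a, b], continuous (fun t => f (t +i* c))}.
  by apply: hor; rewrite ?lexx ?cd// lt_eqF.
have hd : {in `[a, b], continuous (fun t => f (t +i* d))}.
  by apply: hor; rewrite ?lexx ?cd// gt_eqF.
have v1 : {in `[c, d], continuous (fun t => f ((x - r) +i* t))}.
  by apply: ver; rewrite ?a1 ?(le_trans a2)// lt_eqF// ltrBlDr ltrDl.
have v2 : {in `[c, d], continuous (fun t => f ((x + r) +i* t))}.
  by apply: ver; rewrite ?a3 ?(le_trans a1)// gt_eqF// ltrDl.
have m1 : a <= x - r <= b by rewrite a1 (le_trans a2).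
have m2 : x - r <= x + r <= b by rewrite a2 a3.
have m3 : c <= y - r <= d by rewrite c1 (le_trans c2).
have m4 : y - r <= y + r <= d by rewrite c2 c3.
have hc' : {in `[x - r, b], continuous (fun t => f (t +i* c))}.
  by move=> t; rewrite in_itv /= => /andP[t1 t2]; apply: hc; rewrite in_itv /= t2 (le_trans a1).
have hd' : {in `[x - r, b], continuous (fun t => f (t +i* d))}.
  by move=> t; rewrite in_itv /= => /andP[t1 t2]; apply: hd; rewrite in_itv /= t2 (le_trans a1).
have v1' : {in `[y - r, d], continuous (fun t => f ((x - r) +i* t))}.
  by move=> t; rewrite in_itv /= => /andP[t1 t2]; apply: v1; rewrite in_itv /= t2 (le_trans c1).
have v2' : {in `[y - r, d], continuous (fun t => f ((x + r) +i* t))}.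
  by move=> t; rewrite in_itv /= => /andP[t1 t2]; apply: v2; rewrite in_itv /= t2 (le_trans c1).
have G a' b' c' d' : a <= a' -> a' <= b' -> b' <= b -> c <= c' -> c' <= d' -> d' <= d ->
    ~ rectangle a' b' c' d' w -> contour f a' b' c' d' = 0.
  move=> aa ab bb cc cd' dd nw; apply: goursat => // z rz; apply: df.
    move: rz => [/andP[z1 z2] /andP[z3 z4]].
    by split; rewrite ?(le_trans aa z1) ?(le_trans z2 bb) ?(le_trans cc z3)
      ?(le_trans z4 dd).
  by apply: contra_notN nw => /eqP <-.
have lt1 (u : R) : (u <= u - r) = false by rewrite lerDl oppr_ge0 leNgt rp.
have lt2 (u : R) : (u + r <= u) = false by rewrite gerDl leNgt rp.
have G1 : contour f a (x - r) c d = 0.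
  by apply: G; rewrite ?lexx ?(le_trans a2)// /rectangle /= -wE /= lt1 andbF => -[].
have G2 : contour f (x + r) b c d = 0.
  by apply: G; rewrite ?lexx ?(le_trans a1)// /rectangle /= -wE /= lt2 => -[].
have G3 : contour f (x - r) (x + r) c (y - r) = 0.
  by apply: G; rewrite ?lexx ?(le_trans c2)// /rectangle /= -wE /= lt1 andbF => -[].
have G4 : contour f (x - r) (x + r) (y + r) d = 0.
  by apply: G; rewrite ?lexx ?(le_trans c1)// /rectangle /= -wE /= lt2 => -[].
rewrite (contour_split_Re m1 hc hd) (contour_split_Re m2 hc' hd').
rewrite (contour_split_Im m3 v1 v2) (contour_split_Im m4 v1' v2').
rewrite G1 G2 G3 G4 add0r addr0 add0r addr0.
have dist z : edges (x - r) (x + r) (y - r) (y + r) z -> r <= cmod (z - w) <= r + r.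
  have nr : `|- r| = r by rewrite normrN gtr0_norm.
  have pr : `|r| = r by rewrite gtr0_norm.
  have bnd (u v : R) : v - r <= u <= v + r -> `|u - v| <= r.
    by move=> ?; rewrite ler_distl.
  move=> ez; apply/andP; split.
    case: ez => -[_ [e1|e1]].
    - by apply: le_trans (normIm_le _); rewrite cImB e1 -wE /= addrAC subrr add0r nr.
    - by apply: le_trans (normIm_le _); rewrite cImB e1 -wE /= addrAC subrr add0r pr.
    - by apply: le_trans (normRe_le _); rewrite cReB e1 -wE /= addrAC subrr add0r nr.
    - by apply: le_trans (normRe_le _); rewrite cReB e1 -wE /= addrAC subrr add0r pr.
  have [zx zy] := edges_rectangle a2 c2 ez.
  apply: le_trans (cmod_le_ReIm _) _; rewrite cReB cImB -wE /=.
  by apply: lerD; exact: bnd.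
have zw z : edges (x - r) (x + r) (y - r) (y + r) z -> z != w.
  by move=> /dist/andP[rz _]; rewrite -subr_eq0 -cmod_gt0 (lt_le_trans rp).
apply: le_trans (cmod_contour_le_cst a2 c2 (M := e / 16 / r) _ _) _.
- move=> z ez; apply: cf (zw z ez).
  have [/andP[z1 z2] /andP[z3 z4]] := edges_rectangle a2 c2 ez.
  by split; rewrite ?(le_trans a1 z1) ?(le_trans z2 a3) ?(le_trans c1 z3)
      ?(le_trans z4 c3).
- move=> z ez; have /andP[d1 d2] := dist z ez.
  rewrite ler_pdivlMr//; apply: le_trans (Hr z (zw z ez) (le_lt_trans d2 rr0)).
  by rewrite ler_wpM2l// cmod_ge0.
- rewrite (_ : 4 * _ * _ = e) //; field; exact: lt0r_neq0.
Qed.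

(** The difference of the two integrands is o(1/|z - w|) at w, by the very
    definition of the derivative. Aiming at f'(w) rather than f(w) makes it
    possible to deduce the continuity of f' afterwards. *)
Lemma cauchy_derivative f (w : C) a b c d :
  a < complex.Re w < b -> c < complex.Im w < d ->
  (forall z, rectangle a b c d z -> derivable f z 1) ->
  contour (fun z => (f z - f w) / (z - w) / (z - w)) a b c d =
  derive1 f w * contour (fun z => 1 / (z - w)) a b c d.
Proof.
move=> xw yw df.
have /andP[ax xb] := xw; have /andP[cy yd] := yw.
have ab : a <= b by rewrite ltW// (lt_trans ax).
have cd : c <= d by rewrite ltW// (lt_trans cy).
have ew z : edges a b c d z -> z != w.
  move=> ez; apply/eqP => zw; move: ez; rewrite zw => -[[_ []]|[_ []]] E; move: xw yw;
  by rewrite E ltxx ?andbF.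
pose g := fun z : C => (f z - f w) / (z - w) / (z - w) : C.
pose h := fun z : C => derive1 f w * (1 / (z - w)) : C.
have dg z : rectangle a b c d z -> z != w -> derivable g z 1.
  move=> rz zw; apply: derivable_quotient => //; apply: derivable_quotient => //.
  by apply: derivableB => //; exact: df.
have di (z : C) : z != w -> derivable (fun z => 1 / (z - w) : C) z 1.
  by move=> zw; exact: derivable_quotient.
have dh (z : C) : z != w -> derivable h z 1.
  move=> zw; apply: (@derivableM R[i] C (cst (derive1 f w)) (fun z => 1 / (z - w))) => //.
  exact: di.
have E : contour (fun z => g z - h z) a b c d = 0.
  apply: (contour_punctured xw yw) => [z rz zw|e e0].
    by apply: derivableB; [exact: dg|exact: dh].
  have wr : rectangle a b c d w.
    by split; rewrite ?(ltW ax) ?(ltW xb) ?(ltW cy) ?(ltW yd).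
  have /is_derive_derive1/derive_cmodP/(_ e e0)[r r0 Hr] := df w wr.
  exists r => // z zw zr.
  have zw0 : z - w != 0 by rewrite subr_eq0.
  have -> : g z - h z = (f z - f w - (z - w) * derive1 f w) / (z - w) / (z - w).
    by rewrite /g /h; move: (derive1 f w) => l; field.
  rewrite -cmodM divfK// cmodM cmodV ler_pdivrMr ?cmod_gt0//.
  exact: Hr.
have cg z : edges a b c d z -> {for (z : C), continuous g}.
  move=> ez; apply: derivable_continuousC; apply: dg (ew z ez).
  exact: edges_rectangle ez.
have ci z : edges a b c d z -> {for (z : C), continuous (fun z => 1 / (z - w) : C)}.
  by move=> ez; apply: derivable_continuousC; exact: di (ew z ez).
have ch z : edges a b c d z -> {for (z : C), continuous h}.
  by move=> ez; apply: derivable_continuousC; exact: dh (ew z ez).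
have c0 z : edges a b c d z -> {for (z : C), continuous (fun _ : C => 0 : C)}.
  by move=> _; exact: continuousC_cst.
move: E; rewrite (contourB cg ch) => /eqP; rewrite subr_eq0 => /eqP ->.
have := contour_linear (derive1 f w) ci c0.
have -> : contour (fun _ : C => 0 : C) a b c d = 0.
  have := contour_affine 0 0 0 ab cd.
  by under [X in contour X]eq_fun do rewrite mulr0 addr0.
rewrite addr0 => <-; congr (contour _ a b c d).
by apply/funext => z; rewrite /h addr0.
Qed.
End CauchyFormula.

(** * Cauchy's estimate *)

Section DerivativeBounds.
Variable R : realType.
Notation C := (R[i]^o).
Implicit Types f g : C -> C.

(** The four sides move independently, which makes it possible to choose them
    by averaging. *)
Definition framed (w : R[i]) (r a b c d : R) : Prop :=
  [/\ complex.Re w - 2 * r <= a <= complex.Re w - r,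
      complex.Re w + r <= b <= complex.Re w + 2 * r,
      complex.Im w - 2 * r <= c <= complex.Im w - r &
      complex.Im w + r <= d <= complex.Im w + 2 * r].

Lemma framed_ltgt w r a b c d : 0 < r -> framed w r a b c d ->
  [/\ a < complex.Re w < b, c < complex.Im w < d, a <= b & c <= d].
Proof.
move=> r0 [/andP[? ?] /andP[? ?] /andP[? ?] /andP[? ?]].
split; [apply/andP; split| apply/andP; split| |]; lra.
Qed.

Lemma framed_dist w r a b c d z : 0 < r -> framed w r a b c d ->
  edges a b c d z -> r <= cmod (z - w).
Proof.
move=> r0 [/andP[? ?] /andP[? ?] /andP[? ?] /andP[? ?]] [] [_] [] E.
- apply: le_trans (normIm_le _); rewrite cImB E ler_normr; apply/orP; right; lra.
- apply: le_trans (normIm_le _); rewrite cImB E ler_normr; apply/orP; left; lra.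
- apply: le_trans (normRe_le _); rewrite cReB E ler_normr; apply/orP; right; lra.
- apply: le_trans (normRe_le _); rewrite cReB E ler_normr; apply/orP; left; lra.
Qed.

Lemma kernel_lower (r u v : R) : 0 < r -> r <= u <= 2 * r -> - (2 * r) <= v <= 2 * r ->
  (8 * r)^-1 <= u / (u ^+ 2 + v ^+ 2).
Proof.
move=> r0 /andP[u1 u2] /andP[v1 v2].
have u0 : 0 < u by exact: lt_le_trans u1.
have q0 : 0 < u ^+ 2 + v ^+ 2 by rewrite ltr_wpDr ?sqr_ge0// exprn_gt0.
rewrite ler_pdivlMr// mulrC ler_pdivrMr ?mulr_gt0//.
have : u ^+ 2 <= 2 * r * u by rewrite expr2 ler_pM2r.
have : v ^+ 2 <= (2 * r) ^+ 2.
  rewrite -subr_ge0.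
  have -> : (2 * r) ^+ 2 - v ^+ 2 = (2 * r - v) * (2 * r + v) by ring.
  by rewrite mulr_ge0//; lra.
have : r * r <= r * u by rewrite ler_pM2l.
by rewrite exprMn (expr2 r); nra.
Qed.

Lemma Re_inv (z : R[i]) : complex.Re (1 / z) =
  complex.Re z / (complex.Re z ^+ 2 + complex.Im z ^+ 2).
Proof. by rewrite mul1r; case: z. Qed.

Lemma Im_inv (z : R[i]) : complex.Im (1 / z) =
  - complex.Im z / (complex.Im z ^+ 2 + complex.Re z ^+ 2).
Proof. by rewrite mul1r; case: z => x y /=; rewrite addrC mulNr. Qed.

Lemma Rintegral_segment_le_cst (a b : R) (u : R -> R) (m : R) : a <= b ->
  {in `[a, b], continuous u} -> (forall s, s \in `[a, b] -> u s <= m) ->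
  \int[@lebesgue_measure R]_(s in `[a, b]) u s <= m * (b - a).
Proof.
move=> ab cu um; rewrite -Rintegral_segment_cst//.
apply: le_Rintegral => //; first exact: continuous_segment_integrable.
by apply: continuous_segment_integrable => s _; exact: cvg_cst.
Qed.

(** The contour of 1/(z - w) is 2 i pi. Each of the four sides is seen from w
    under an angle bounded below and contributes at least 1/4 to its imaginary
    part. *)
Lemma Im_contour_kernel_ge1 (w : C) r a b c d : 0 < r -> framed w r a b c d ->
  1 <= complex.Im (contour (fun z => 1 / (z - w)) a b c d).
Proof.
move=> r0 wF; have [xw yw ab cd] := framed_ltgt r0 wF.
have ci z : edges a b c d z -> {for (z : C), continuous (fun z => 1 / (z - w) : C)}.
  move=> /(framed_dist r0 wF) rz; apply: derivable_continuousC.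
  apply: derivable_quotient; last exact: derivable_cst.
  by rewrite -subr_eq0 -cmod_gt0 (lt_le_trans r0).
have [k1 k2 k3 k4] := continuous_edges ci.
have ReC (g : R -> C) u v : {in `[u, v], continuous g} ->
    {in `[u, v], continuous (fun s => complex.Re (g s))}.
  by move=> cg s /cg cgs; exact: (@continuous_comp _ _ _ g (@complex.Re R : C -> R))
    (@continuous_Re R (g s)).
have ImC (g : R -> C) u v : {in `[u, v], continuous g} ->
    {in `[u, v], continuous (fun s => complex.Im (g s))}.
  by move=> cg s /cg cgs; exact: (@continuous_comp _ _ _ g (@complex.Im R : C -> R))
    (@continuous_Im R (g s)).
pose m := (8 * r)^-1.
have E (z1 z2 z3 z4 : R[i]) : complex.Im (z1 - z2 + 'i * (z3 - z4)) =
    complex.Im z1 - complex.Im z2 + (complex.Re z3 - complex.Re z4).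
  by rewrite cImD cImB cImM cReB /= mul0r mul1r add0r.
have m0 : 0 < m by rewrite invr_gt0 mulr_gt0.
have m4 : 1 = m * (2 * r) + m * (2 * r) + (m * (2 * r) + m * (2 * r)).
  by rewrite /m; field; rewrite gt_eqF.
move: wF => [/andP[a1 a2] /andP[b1 b2] /andP[c1 c2] /andP[d1 d2]].
have lx : 2 * r <= b - a by lra.
have ly : 2 * r <= d - c by lra.
have side : m * (2 * r) <= m * (b - a) by rewrite ler_pM2l.
have side' : m * (2 * r) <= m * (d - c) by rewrite ler_pM2l.
rewrite /contour E {1}m4 /cint /=; apply: lerD; apply: lerD.
- apply: le_trans side _.
  apply: Rintegral_segment_ge_cst => //; first exact: (ImC _ _ _ k1).
  move=> s; rewrite in_itv /= => /andP[s1 s2]; rewrite Im_inv cImB cReB /=.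
  rewrite -(sqrrN (c - _)).
  by apply: kernel_lower => //; apply/andP; split; lra.
- apply: le_trans side _; rewrite lerNr -mulNr.
  apply: Rintegral_segment_le_cst => //; first exact: (ImC _ _ _ k2).
  move=> s; rewrite in_itv /= => /andP[s1 s2]; rewrite Im_inv cImB cReB /=.
  rewrite lerNr mulNr opprK.
  by apply: kernel_lower => //; apply/andP; split; lra.
- apply: le_trans side' _.
  apply: Rintegral_segment_ge_cst => //; first exact: (ReC _ _ _ k3).
  move=> s; rewrite in_itv /= => /andP[s1 s2]; rewrite Re_inv cImB cReB /=.
  by apply: kernel_lower => //; apply/andP; split; lra.
- apply: le_trans side' _; rewrite lerNr -mulNr.
  apply: Rintegral_segment_le_cst => //; first exact: (ReC _ _ _ k4).
  move=> s; rewrite in_itv /= => /andP[s1 s2]; rewrite Re_inv cImB cReB /=.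
  rewrite lerNr -mulNr -(sqrrN (a - _)).
  by apply: kernel_lower => //; apply/andP; split; lra.
Qed.

Lemma cauchy_estimate f (w : C) r M : 0 < r ->
  let a := complex.Re w - r in let b := complex.Re w + r in
  let c := complex.Im w - r in let d := complex.Im w + r in
  (forall z, rectangle a b c d z -> derivable f z 1) ->
  (forall z, rectangle a b c d z -> cmod (f z - f w) <= M) ->
  cmod (derive1 f w) <= 16 * M / r.
Proof.
move=> r0 a b c d df fM.
have wF : framed w r a b c d by split; apply/andP; split; rewrite /a /b /c /d; lra.
have [xw yw ab cd] := framed_ltgt r0 wF.
have k1 : 1 <= cmod (contour (fun z => 1 / (z - w)) a b c d).
  apply: le_trans (Im_contour_kernel_ge1 r0 wF) _.
  exact: le_trans (ler_norm _) (normIm_le _).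
apply: (@le_trans _ _ (cmod (contour (fun z => (f z - f w) / (z - w) / (z - w)) a b c d))).
  by rewrite cauchy_derivative// cmodM ler_peMr// cmod_ge0.
apply: le_trans (cmod_contour_le_cst ab cd (M := M / r / r) _ _) _.
- move=> z ez; apply: derivable_continuousC.
  have zw : z != w by rewrite -subr_eq0 -cmod_gt0 (lt_le_trans r0)// (framed_dist r0 wF ez).
  apply: derivable_quotient => //; apply: derivable_quotient => //.
  by apply: derivableB => //; apply: df; exact: edges_rectangle ez.
- move=> z ez; have rz := framed_dist r0 wF ez.
  have z0 : 0 < cmod (z - w) by exact: lt_le_trans rz.
  have Mz := fM z (edges_rectangle ab cd ez).
  have M0 : 0 <= M by apply: le_trans (cmod_ge0 _) Mz.
  rewrite !cmodM !cmodV -!mulrA; apply: ler_pM => //; rewrite ?cmod_ge0//.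
    by rewrite mulr_ge0 ?invr_ge0 ?cmod_ge0.
  by rewrite -!invfM lef_pV2 ?posrE ?mulr_gt0// ler_pM// ltW.
- rewrite (_ : 4 * _ * _ = 16 * M / r) //.
  by rewrite /a /b /c /d; field; rewrite gt_eqF.
Qed.

End DerivativeBounds.

(** * Continuity of the derivative *)

Section DerivativeContinuity.
Variable R : realType.
Notation C := (R[i]^o).
Implicit Types f g : C -> C.

(** Heine's theorem; bisection replaces an appeal to compactness. *)
Lemma rectangle_uniform_continuity f a b c d (e : R) : 0 < e -> a <= b -> c <= d ->
  (forall z, rectangle a b c d z -> {for (z : C), continuous f}) ->
  exists2 r : R, 0 < r & forall z h, rectangle a b c d z -> cmod h < r ->
    cmod (f (z + h) - f z) < e.
Proof.
move=> e0 ab cd cf.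
pose P n x y := exists2 r : R, 0 < r & forall z h,
  rectangle x (x + (b - a) / 2 ^+ n) y (y + (d - c) / 2 ^+ n) z -> cmod h < r ->
    cmod (f (z + h) - f z) < e.
suff : P 0%N a c by rewrite /P !expr0 !divr1 (addrC a) (addrC c) !subrK.
have s0 : 0 <= b - a by rewrite subr_ge0.
have h0 : 0 <= d - c by rewrite subr_ge0.
apply: (rectangle_bisection s0 h0).
- move=> n x y [r1 r10 P1] [r2 r20 P2] [r3 r30 P3] [r4 r40 P4].
  have [r r0 [k1 k2 k3 k4 _]] := min5_gt0 r10 r20 r30 r40 r40.
  exists r => // z h [/andP[z1 z2] /andP[z3 z4]] hr.
  have half s : s / 2 ^+ n = s / 2 ^+ n.+1 + s / 2 ^+ n.+1 :> R.
    by rewrite exprS; field; rewrite expf_neq0.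
  move: z2 z4; rewrite !half !addrA => z2 z4.
  have [zx|/ltW zx] := lerP (complex.Re z) (x + (b - a) / 2 ^+ n.+1);
  have [zy|/ltW zy] := lerP (complex.Im z) (y + (d - c) / 2 ^+ n.+1).
  + by apply: P1; [split; apply/andP; split|exact: lt_le_trans k1].
  + by apply: P3; [split; apply/andP; split|exact: lt_le_trans k3].
  + by apply: P2; [split; apply/andP; split|exact: lt_le_trans k2].
  + by apply: P4; [split; apply/andP; split|exact: lt_le_trans k4].
- move=> X Y; rewrite (addrC a) (addrC c) !subrK => aX cY.
  have e2 : 0 < e / 2 by rewrite divr_gt0.
  have rXY : rectangle a b c d (X +i* Y) by split.
  have /continuous_cmodP/(_ _ e2)[r r0 Hr] := cf _ rXY.
  have r2 : 0 < r / 2 by rewrite divr_gt0.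
  have [N HN] := dyadic_small ((b - a) + (d - c)) r2.
  exists N => n x y Nn _ _ _ _ Xx Yy; exists (r / 2) => // z h [zx zy] hr.
  have zr : cmod (z - (X +i* Y)) < r / 2.
    apply: le_lt_trans (HN n Nn); rewrite mulrDl.
    apply: le_trans (cmod_le_ReIm _) _; rewrite cReB cImB.
    by apply: lerD; [exact: dist_segment zx Xx|exact: dist_segment zy Yy].
  have zhr : cmod (z + h - (X +i* Y)) < r.
    by rewrite addrAC [r]splitr; apply: le_lt_trans (cmodD _ _) _; rewrite ltrD.
  have /Hr A : cmod (z - (X +i* Y)) < r.
    by apply: lt_trans zr _; rewrite ltr_pdivrMr// ltr_pMr// ltrDl.
  have B := Hr _ zhr.
  have -> : f (z + h) - f z = f (z + h) - f (X +i* Y) - (f z - f (X +i* Y)).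
    by rewrite opprB addrA subrK.
  by rewrite [e]splitr; apply: le_lt_trans (cmodB _ _) _; rewrite ltrD.
Qed.

Lemma is_derive_shift f (z h l : C) : is_derive (z + h) 1 f l ->
  is_derive z 1 (fun u : C => f (u + h)) l.
Proof.
move=> /derive_cmodP H; apply/derive_cmodP => e /H[r r0 {}H].
exists r => // u uz; have := H (u + h).
by rewrite opprD addrACA subrr addr0; exact.
Qed.

(** The derivative at w + h minus the derivative at w is the derivative at w of
    z |-> f (z + h) - f z, which Cauchy's estimate controls by the modulus of
    continuity of f. *)
Lemma derive1_continuous f (w : C) (r : R) : 0 < r ->
  (forall z : C, cmod (z - w) < r -> derivable f z 1) ->
  {for w, continuous (derive1 f)}.
Proof.
move=> r0 df; pose s := r / 8.
have s0 : 0 < s by rewrite divr_gt0.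
pose a := complex.Re w - s; pose b := complex.Re w + s.
pose c := complex.Im w - s; pose d := complex.Im w + s.
have near_w z : rectangle a b c d z -> cmod (z - w) <= 2 * s.
  move=> [zx zy]; apply: le_trans (cmod_le_ReIm _) _; rewrite cReB cImB.
  by rewrite mulr_natl mulr2n; apply: lerD; rewrite ler_distl.
have ab : a <= b by rewrite /a /b; lra.
have cd : c <= d by rewrite /c /d; lra.
have s2 : 2 * s < r by rewrite /s; lra.
have s3 : 2 * s + s < r by rewrite /s; lra.
have cf z : rectangle a b c d z -> {for (z : C), continuous f}.
  by move=> /near_w zw; apply: derivable_continuousC; apply: df; exact: le_lt_trans s2.
apply/continuous_cmodP => e e0.
have k0 : 0 < e * s / 64 by rewrite !divr_gt0 ?mulr_gt0.
have [t t0 Ht] := rectangle_uniform_continuity k0 ab cd cf.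
exists (Num.min t s) => [|v]; first by rewrite lt_min t0.
rewrite lt_min => /andP[vt vs]; pose h := v - w.
have dh z : rectangle a b c d z -> is_derive (z : C) 1 (fun u : C => f (u + h) - f u : C)
    (derive1 f (z + h) - derive1 f z).
  move=> /near_w zw; apply: is_deriveB.
    apply: is_derive_shift; apply: is_derive_derive1; apply: df.
    rewrite addrAC; apply: le_lt_trans s3; apply: le_trans (cmodD _ _) _.
    by apply: lerD => //; exact: ltW.
  by apply: is_derive_derive1; apply: df; exact: le_lt_trans s2.
have ww : rectangle a b c d w by split; rewrite /a /b /c /d; apply/andP; split; lra.
have -> : derive1 f v - derive1 f w = derive1 (fun u : C => f (u + h) - f u : C) w.
  have hv : w + h = v by rewrite /h addrC subrK.
  by rewrite (is_derive_derive1E (dh w ww)) hv.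
have D1 z : rectangle a b c d z -> derivable (fun u : C => f (u + h) - f u : C) z 1.
  by move=> rz; have [] := dh z rz.
have D2 z : rectangle a b c d z ->
    cmod (f (z + h) - f z - (f (w + h) - f w)) <= e * s / 64 + e * s / 64.
  move=> rz; apply: le_trans (cmodB _ _) _.
  by apply: lerD; apply: ltW; apply: Ht.
apply: le_lt_trans (cauchy_estimate s0 D1 D2) _.
rewrite (_ : 16 * _ / s = e / 2); last by field; rewrite gt_eqF.
by rewrite ltr_pdivrMr// ltr_pMr// ltrDl.
Qed.

(** The derivative of (f z - f w)/(z - w) is f'(z)/(z - w) minus the integrand
    of Cauchy's formula. The contour of a derivative vanishes, so that integrand may
    be replaced by f'(z)/(z - w), which on the sides is at most |f'(z)|/r. *)
Lemma derive1_le_sides f (w : C) r a b c d : 0 < r -> framed w r a b c d ->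
  (forall z, rectangle a b c d z -> derivable f z 1) ->
  (forall z, rectangle a b c d z -> {for (z : C), continuous (derive1 f)}) ->
  r * cmod (derive1 f w) <= 2 *
    (\int[@lebesgue_measure R]_(s in `[a, b]) cmod (derive1 f (s +i* c)) +
     \int[@lebesgue_measure R]_(s in `[a, b]) cmod (derive1 f (s +i* d)) +
     \int[@lebesgue_measure R]_(s in `[c, d]) cmod (derive1 f (b +i* s)) +
     \int[@lebesgue_measure R]_(s in `[c, d]) cmod (derive1 f (a +i* s))).
Proof.
move=> r0 wF df cdf; have [xw yw ab cd] := framed_ltgt r0 wF.
have zw z : edges a b c d z -> z != w.
  by move=> /(framed_dist r0 wF) rz; rewrite -subr_eq0 -cmod_gt0 (lt_le_trans r0).
have er := edges_rectangle ab cd.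
pose F := fun z : C => (f z - f w) / (z - w) : C.
pose g := fun z : C => derive1 f z / (z - w) : C.
pose h := fun z : C => (f z - f w) / (z - w) / (z - w) : C.
have ci z : edges a b c d z -> {for (z : C), continuous (fun u : C => (u - w)^-1 : C)}.
  move=> ez; apply: continuousC_V; first by rewrite subr_eq0 zw.
  by apply: continuousC_B; [exact: cvg_id|exact: continuousC_cst].
have cg z : edges a b c d z -> {for (z : C), continuous g}.
  by move=> ez; exact: (continuousC_M (cdf z (er z ez)) (ci z ez)).
have dF z : edges a b c d z -> is_derive (z : C) 1 F (g z - h z).
  move=> ez; apply: (@is_derive_quotient R[i]); first exact: zw.
  have d1 := is_derive_derive1 (df z (er z ez)).
  by apply: is_derive_eq; rewrite subr0.
have ch z : edges a b c d z -> {for (z : C), continuous h}.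
  move=> ez.
  have [/derivable_continuousC cF _] := dF z ez.
  exact: (continuousC_M cF (ci z ez)).
have E : contour h a b c d = contour g a b c d.
  have := contour_derivative ab cd (fun z ez => continuousC_B (cg z ez) (ch z ez)) dF.
  by rewrite (contourB cg ch) => /eqP; rewrite subr_eq0 => /eqP.
have k1 : 1 <= cmod (contour (fun z => 1 / (z - w)) a b c d).
  apply: le_trans (Im_contour_kernel_ge1 r0 wF) _.
  exact: le_trans (ler_norm _) (normIm_le _).
have le1 : cmod (derive1 f w) <= cmod (contour g a b c d).
  by rewrite -E /h cauchy_derivative// cmodM ler_peMr// cmod_ge0.
have cm z : edges a b c d z -> {for (z : C), continuous (fun z => cmod (derive1 f z))}.
  move=> ez; exact: (@continuous_comp _ _ _ (derive1 f) (@cmod R : C -> R) z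
    (cdf z (er z ez)) (@continuous_cmod R _)).
have gle z : edges a b c d z -> cmod (g z) <= r^-1 * cmod (derive1 f z).
  move=> ez; rewrite /g cmodM cmodV mulrC ler_wpM2r ?cmod_ge0//.
  have rz := framed_dist r0 wF ez.
  by rewrite lef_pV2// posrE (lt_le_trans r0).
have [v1 v2 v3 v4] := continuous_edges cm.
have W (u : R -> R) x y : {in `[x, y], continuous u} ->
    {in `[x, y], continuous (fun s => r^-1 * u s)}.
  move=> cu s /cu cus; exact: (@continuousM R R (fun=> r^-1) u s (cvg_cst _) cus).
have Z (u : R -> R) x y : {in `[x, y], continuous u} ->
    \int[@lebesgue_measure R]_(s in `[x, y]) (r^-1 * u s) <=
    r^-1 * \int[@lebesgue_measure R]_(s in `[x, y]) u s.
  by move=> cu; rewrite RintegralZl//; exact: continuous_segment_integrable.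
have H := cmod_contour_le cg (W _ _ _ v1) (W _ _ _ v2) (W _ _ _ v3) (W _ _ _ v4).
rewrite -ler_pdivlMl//; apply: le_trans le1 _.
apply: (le_trans (H _ _ _ _)) => [s|s|s|s|].
- by rewrite in_itv /= => hs; apply: gle; left; split => //; left.
- by rewrite in_itv /= => hs; apply: gle; left; split => //; right.
- by rewrite in_itv /= => hs; apply: gle; right; split => //; right.
- by rewrite in_itv /= => hs; apply: gle; right; split => //; left.
rewrite mulrCA ler_pM2l// !mulrDr.
apply: lerD; last exact: Z v4.
apply: lerD; last exact: Z v3.
by apply: lerD; [exact: Z v1|exact: Z v2].
Qed.

End DerivativeContinuity.

(** * Measurability in the plane *)

Section PlanarMeasure.
Variable R : realType.
Notation C := (R[i]^o).
Notation mu := (@lebesgue_measure R).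

(** Such a set is a countable union of squares with rational centers; open is
    meant for the modulus, which spares a comparison of topologies. *)
Lemma planar_open_measurable (W : set R[i]) :
  (forall z, W z -> exists2 d : R, 0 < d & forall u, cmod (u - z) < d -> W u) ->
  measurable [set p : R * R | W (p.1 +i* p.2)].
Proof.
move=> oW; set U := [set p : R * R | W (p.1 +i* p.2)].
pose box (q : rat * rat * nat) : set (R * R) :=
  ball (ratr q.1.1 : R) (q.2.+1%:R^-1 : R) `*` ball (ratr q.1.2 : R) (q.2.+1%:R^-1 : R).
pose F q := if pselect (box q `<=` U) is left _ then box q else set0.
have -> : U = \bigcup_q F q.
  apply/seteqP; split => [[x y] /= Wxy|p [q _]]; last first.
    by rewrite /F; case: pselect => // sub /sub.
  have [d d0 Hd] := oW _ Wxy.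
  pose n := Num.truncn (4 / d); pose k : R := n.+1%:R^-1.
  have k0 : 0 < k by rewrite invr_gt0.
  have kd : 4 * k < d.
    rewrite /k ltr_pdivrMr// mulrC -ltr_pdivrMr//; exact: truncnS_gt.
  have [q1 /andP[q11 q12]] : exists q : rat, x - k < ratr q < x + k.
    have : x - k < x + k by rewrite ltrD2l gtrN.
    by move=> /rat_in_itvoo[q]; rewrite in_itv /=; exists q.
  have [q2 /andP[q21 q22]] : exists q : rat, y - k < ratr q < y + k.
    have : y - k < y + k by rewrite ltrD2l gtrN.
    by move=> /rat_in_itvoo[q]; rewrite in_itv /=; exists q.
  exists (q1, q2, n) => //; rewrite /F; case: pselect => [_|]; last first.
    case=> -[x' y'] [] /=; rewrite /ball /= !ltr_distl -/k => /andP[a1 a2] /andP[b1 b2].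
    apply: Hd; apply: le_lt_trans kd; apply: le_trans (cmod_le_ReIm _) _.
    rewrite cReB cImB /= (_ : 4 * k = 2 * k + 2 * k); last by rewrite -mulrDl -natrD.
    by apply: lerD; rewrite ler_norml; apply/andP; split; lra.
  by split; rewrite /= /ball /= !ltr_distl -/k; apply/andP; split; lra.
apply: countable_bigcupT_measurable => [|q]; first exact: countableP.
rewrite /F; case: pselect => // _; apply: measurableX; exact: measurable_ball.
Qed.

Lemma planar_continuous_measurable (W : set R[i]) (u : C -> R) :
  (forall z, W z -> exists2 d : R, 0 < d & forall v, cmod (v - z) < d -> W v) ->
  (forall z, W z -> {for (z : C), continuous u}) ->
  measurable_fun [set p : R * R | W (p.1 +i* p.2)] (fun p => u (p.1 +i* p.2)).
Proof.
move=> oW cu mW; apply: (measurability _ (RGenOInfty.measurableE R)) => //.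
move=> _ [_ [t ->] <-].
rewrite (_ : _ `&` _ = [set p : R * R | [set z | W z /\ t < u z] (p.1 +i* p.2)]); last first.
  by apply/seteqP; split => p /= []; rewrite in_itv /= andbT.
apply: planar_open_measurable => z [Wz tz].
have [d d0 Hd] := oW z Wz.
have e0 : 0 < u z - t by rewrite subr_gt0.
have /continuousR_cmodP/(_ _ e0)[r r0 Hr] := cu z Wz.
exists (Num.min d r) => [|v]; first by rewrite lt_min d0.
rewrite lt_min => /andP[/Hd Wv /Hr]; rewrite ltr_norml => /andP[_ H]; split => //.
by lra.
Qed.

(** The integral form of the pigeonhole principle. *)
Lemma exists_le_average (A : R -> \bar R) (I K u v : R) :
  measurable_fun setT A -> (forall x, (0 <= A x)%E) ->
  (\int[mu]_x A x <= I%:E)%E -> u < v -> 0 <= K -> I < K * (v - u) ->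
  exists2 x, u <= x <= v & (A x <= K%:E)%E.
Proof.
move=> mA A0 AI uv K0 IK; apply: contrapT => /forall2NP none.
have big x : u <= x <= v -> (K%:E <= A x)%E.
  by move=> xuv; have [|/negP] := none x; [by []|rewrite -ltNge => /ltW].
have : (\int[mu]_(x in `[u, v]) A x <= I%:E)%E.
  by apply: le_trans AI; apply: ge0_subset_integral.
apply/negP; rewrite -ltNge; apply: (@lt_le_trans _ _ (K * (v - u))%:E).
  by rewrite lte_fin.
apply: (@le_trans _ _ (\int[mu]_(x in `[u, v]) (cst K%:E) x)%E).
  rewrite integral_cst//= lebesgue_measure_itv /= lte_fin uv.
  by rewrite -EFinD -EFinM.
apply: ge0_le_integral => //.
exact: measurable_funTS.
Qed.

End PlanarMeasure.

(** * The derivative is bounded by its area average *)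

Section AreaBound.
Variable R : realType.
Notation C := (R[i]^o).
Notation mu := (@lebesgue_measure R).

Lemma unit_disk_open (z : R[i]) : unit_disk z ->
  exists2 d : R, 0 < d & forall v, cmod (v - z) < d -> unit_disk v.
Proof.
rewrite unit_diskE => z1; exists (1 - cmod z) => [|v vz]; first by rewrite subr_gt0.
rewrite unit_diskE -(subrK z v); apply: le_lt_trans (cmodD _ _) _.
by rewrite -ltrBrDr.
Qed.

Lemma derive1_continuous_disk (f : C -> C) (z : C) : holomorphic_disk f ->
  unit_disk z -> {for z, continuous (derive1 f)}.
Proof.
move=> hf z1; have [d d0 Hd] := unit_disk_open z1.
by apply: (derive1_continuous d0) => v vz; apply: hf; exact: Hd.
Qed.

Lemma derive1_measurable (f : C -> C) : holomorphic_disk f ->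
  measurable_fun [set p : R * R | unit_disk (p.1 +i* p.2)]
    (fun p => cmod (derive1 f (p.1 +i* p.2))).
Proof.
move=> hf.
apply: (@planar_continuous_measurable R (@unit_disk R) (fun z : C => cmod (derive1 f z))).
  exact: unit_disk_open.
move=> z z1; exact: (@continuous_comp _ _ _ (derive1 f) (@cmod R : C -> R) z
  (derive1_continuous_disk hf z1) (@continuous_cmod R _)).
Qed.

Lemma Rintegral_segment_le_total (A : R -> \bar R) (h : R -> R) (u v K : R) :
  {in `[u, v], continuous h} -> (forall s, u <= s <= v -> A s = (h s)%:E) ->
  measurable_fun setT A -> (forall s, (0 <= A s)%E) ->
  (\int[mu]_s A s <= K%:E)%E -> \int[mu]_(s in `[u, v]) h s <= K.
Proof.
move=> ch Ah mA A0 AK; have ih := continuous_segment_integrable ch.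
have le1 : (\int[mu]_(s in `[u, v]) A s <= \int[mu]_s A s)%E.
  by apply: ge0_subset_integral.
rewrite -lee_fin /Rintegral fineK; last exact: integrable_fin_num ih.
apply: le_trans (le_trans le1 AK).
rewrite le_eqVlt; apply/orP; left; apply/eqP; apply: eq_integral => s.
by rewrite inE /= in_itv => /Ah ->.
Qed.

(** By Tonelli some horizontal and vertical sides carry at most twice the
    average of |f'|; the side lengths being comparable to r, the bound on the
    sides given by Cauchy's formula becomes a bound on the area integral. *)
Lemma derive1_le_area (f : C -> C) (w : C) (r I : R) :
  0 < r -> 0 < I -> holomorphic_disk f ->
  let Q := `[complex.Re w - 2 * r, complex.Re w + 2 * r] `*`
           `[complex.Im w - 2 * r, complex.Im w + 2 * r] in
  (forall p, Q p -> unit_disk (p.1 +i* p.2)) ->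
  (\int[mu \x mu]_(p in Q) (cmod (derive1 f (p.1 +i* p.2)))%:E <= I%:E)%E ->
  r ^+ 2 * cmod (derive1 f w) <= 16 * I.
Proof.
move=> r0 I0 hf Q Qdisk QI.
have mQ : measurable Q by apply: measurableX.
pose N := ((fun p : R * R => (cmod (derive1 f (p.1 +i* p.2)))%:E) \_ Q)%E.
have mN : measurable_fun setT N.
  apply/(measurable_restrictT _ mQ)/measurable_EFinP.
  apply: measurable_funS (derive1_measurable hf) => //.
  by apply: (@planar_open_measurable R (@unit_disk R)); exact: unit_disk_open.
have N0 p : (0 <= N p)%E.
  by rewrite /N patchE; case: ifP => // _; rewrite lee_fin cmod_ge0.
have NI : (\int[mu \x mu]_p N p <= I%:E)%E by rewrite -integral_mkcond.
have FI : (\int[mu]_x fubini_F mu N x <= I%:E)%E by rewrite -fubini_tonelli1.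
have GI : (\int[mu]_y fubini_G mu N y <= I%:E)%E by rewrite -fubini_tonelli2.
have F0 x : (0 <= fubini_F mu N x)%E by apply: integral_ge0 => y _; exact: N0.
have G0 y : (0 <= fubini_G mu N y)%E by apply: integral_ge0 => x _; exact: N0.
have mF : measurable_fun setT (fubini_F mu N) by exact: measurable_fun_fubini_tonelli_F.
have mG : measurable_fun setT (fubini_G mu N) by exact: measurable_fun_fubini_tonelli_G.
pose K := 2 * I / r.
have K0 : 0 <= K by rewrite divr_ge0 ?mulr_ge0// ltW.
have IK u v : v - u = r -> I < K * (v - u).
  by move=> ->; rewrite /K divfK ?gt_eqF// ltr_pMl// ltrDl.
move: (complex.Re w) (complex.Im w) (ReIm_eta w) @Q Qdisk QI mQ @N mN N0 NI FI GI F0 G0 mF mG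
  => x y wE Q Qdisk QI mQ N mN N0 NI FI GI F0 G0 mF mG.
have lt1 t : t - 2 * r < t - r by lra.
have lt2 t : t + r < t + 2 * r by lra.
have e1 t : t - r - (t - 2 * r) = r by ring.
have e2 t : t + 2 * r - (t + r) = r by ring.
have [a ha Fa] := exists_le_average mF F0 FI (lt1 x) K0 (IK _ _ (e1 x)).
have [b hb Fb] := exists_le_average mF F0 FI (lt2 x) K0 (IK _ _ (e2 x)).
have [c hc Gc] := exists_le_average mG G0 GI (lt1 y) K0 (IK _ _ (e1 y)).
have [d hd Gd] := exists_le_average mG G0 GI (lt2 y) K0 (IK _ _ (e2 y)).
have wF : framed w r a b c d by rewrite -wE.
have ia : x - 2 * r <= a <= x + 2 * r by lra.
have ib : x - 2 * r <= b <= x + 2 * r by lra.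
have ic : y - 2 * r <= c <= y + 2 * r by lra.
have id : y - 2 * r <= d <= y + 2 * r by lra.
have sub (t u v lo hi : R) :
    lo <= u <= hi -> lo <= v <= hi -> u <= t <= v -> lo <= t <= hi.
  move=> /andP[h1 _] /andP[_ h2] /andP[h3 h4].
  by rewrite (le_trans h1 h3) (le_trans h4 h2).
have inQ u v : x - 2 * r <= u <= x + 2 * r -> y - 2 * r <= v <= y + 2 * r -> Q (u, v).
  by move=> hu hv; split; rewrite /= in_itv.
have disk z : rectangle a b c d z -> unit_disk z.
  move=> [zx zy]; rewrite -(ReIm_eta z); apply: (Qdisk (_, _)).
  by apply: inQ; [exact: sub ia ib zx|exact: sub ic id zy].
have cm u v : Q (u, v) -> {for (u +i* v : C), continuous (fun z : C => cmod (derive1 f z))}.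
  move=> /Qdisk uv; exact: (@continuous_comp _ _ _ (derive1 f) (@cmod R : C -> R) _
    (derive1_continuous_disk hf uv) (@continuous_cmod R _)).
have sF u : x - 2 * r <= u <= x + 2 * r -> (fubini_F mu N u <= K%:E)%E ->
    \int[mu]_(s in `[c, d]) cmod (derive1 f (u +i* s)) <= K.
  move=> hu FK.
  have ch : {in `[c, d], continuous (fun s => cmod (derive1 f (u +i* s)))}.
    move=> s; rewrite in_itv /= => hs.
    apply: (@continuous_vertical R R (fun z : C => cmod (derive1 f z))).
    by apply: cm; apply: inQ hu _; exact: sub ic id hs.
  have Nh s : c <= s <= d -> N (u, s) = (cmod (derive1 f (u +i* s)))%:E.
    move=> hs; rewrite /N patchE mem_set //.
    by apply: inQ hu _; exact: sub ic id hs.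
  have mNu := measurableT_comp mN (measurable_fun_pair
    (@measurable_cst _ _ _ _ setT u) (@measurable_id _ _ setT)).
  exact: (Rintegral_segment_le_total ch Nh mNu (fun s => N0 (u, s)) FK).
have sG v : y - 2 * r <= v <= y + 2 * r -> (fubini_G mu N v <= K%:E)%E ->
    \int[mu]_(s in `[a, b]) cmod (derive1 f (s +i* v)) <= K.
  move=> hv GK.
  have ch : {in `[a, b], continuous (fun s => cmod (derive1 f (s +i* v)))}.
    move=> s; rewrite in_itv /= => hs.
    apply: (@continuous_horizontal R R (fun z : C => cmod (derive1 f z))).
    by apply: cm; apply: inQ _ hv; exact: sub ia ib hs.
  have Nh s : a <= s <= b -> N (s, v) = (cmod (derive1 f (s +i* v)))%:E.
    move=> hs; rewrite /N patchE mem_set //.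
    by apply: inQ _ hv; exact: sub ia ib hs.
  have mNv := measurableT_comp mN (measurable_fun_pair
    (@measurable_id _ _ setT) (@measurable_cst _ _ _ _ setT v)).
  exact: (Rintegral_segment_le_total ch Nh mNv (fun s => N0 (s, v)) GK).
have := derive1_le_sides r0 wF (fun z rz => hf z (disk z rz))
  (fun z rz => derive1_continuous_disk hf (disk z rz)).
move=> /le_trans H.
have {}H : r * cmod (derive1 f w) <= 2 * (K + K + K + K).
  apply: H; rewrite ler_pM2l//.
  apply: lerD; last exact: (sF a ia Fa).
  apply: lerD; last exact: (sF b ib Fb).
  by apply: lerD; [exact: (sG c ic Gc)|exact: (sG d id Gd)].
have -> : 16 * I = r * (2 * (K + K + K + K)).
  by rewrite /K; field; rewrite gt_eqF.
by rewrite expr2 -mulrA ler_pM2l.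
Qed.

End AreaBound.

(** * Besov functions are Bloch functions *)

Section BesovBloch.
Variable R : realType.
Notation C := (R[i]^o).
Notation mu := (@lebesgue_measure R).

(** Here g stands for |f'(z)| and q for 1 - |z|^2. Where g exceeds 1/rho, the
    quantity (g rho)^(p - 1) is at least 1 and g is dominated by
    g (g rho)^(p - 1) = rho g^p rho^(p - 2); the weight q^(p - 2) is at least
    rho^(p - 2) because p >= 2. *)
Lemma le_besov_density (p g rho q : R) : 2 <= p -> 0 <= g -> 0 < rho -> rho <= q ->
  g <= rho^-1 + rho * (g `^ p * q `^ (p - 2)).
Proof.
move=> p2 g0 r0 rq.
have [gr|rg] := lerP g rho^-1.
  apply: le_trans gr _; rewrite lerDl mulr_ge0 ?(ltW r0)//.
  by rewrite mulr_ge0 ?powR_ge0.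
have gp : 0 < g by apply: lt_trans rg; rewrite invr_gt0.
have gr1 : 1 <= g * rho by rewrite -ler_pdivrMr// mul1r ltW.
apply: (@le_trans _ _ (rho * (g `^ p * rho `^ (p - 2)))); last first.
  apply: (@le_trans _ _ (rho * (g `^ p * q `^ (p - 2)))).
    rewrite ler_pM2l// ler_wpM2l ?powR_ge0//.
    by apply: ge0_ler_powR; rewrite ?nnegrE ?subr_ge0// ltW// (lt_le_trans r0).
  by rewrite lerDr invr_ge0 ltW.
have -> : rho * (g `^ p * rho `^ (p - 2)) = g * (g * rho) `^ (p - 1).
  rewrite powRM ?(ltW gp) ?(ltW r0)//.
  rewrite -(mulr_powRB1 g0 (_ : 0 < p)); last by lra.
  rewrite -(mulr_powRB1 (ltW r0) (_ : 0 < p - 1)); last by lra.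
  rewrite (_ : p - 1 - 1 = p - 2); last by lra.
  by move: (powR _ _) (powR _ _) => x y; ring.
rewrite ler_peMr//; apply: le_trans (ler_powR gr1 (_ : 0 <= p - 1)); first by rewrite powRr0.
by lra.
Qed.

Lemma besov_density_measurable (p : R) (f : C -> C) : holomorphic_disk f ->
  measurable_fun [set w : R * R | unit_disk (w.1 +i* w.2)]
    (fun w => cmod (derive1 f (w.1 +i* w.2)) `^ p *
              (1 - cmod (w.1 +i* w.2) ^+ 2) `^ (p - 2)).
Proof.
move=> hf; apply: measurable_funM.
  exact: measurableT_comp (measurable_powR p) (derive1_measurable hf).
apply: (measurableT_comp (measurable_powR (p - 2))).
apply: measurable_funB; first exact: measurable_cst.
apply: measurable_funX.
apply: (@planar_continuous_measurable R (@unit_disk R) (@cmod R)).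
  exact: unit_disk_open.
by move=> z _; exact: (@continuous_cmod R).
Qed.

Lemma besov_density_ge0 (p : R) (f : C -> C) (z : C) :
  0 <= cmod (derive1 f z) `^ p * (1 - cmod z ^+ 2) `^ (p - 2).
Proof. by rewrite mulr_ge0 ?powR_ge0. Qed.

Lemma besov_integral_ge0 (p : R) (f : C -> C) : (0 <= besov_integral p f)%E.
Proof. by apply: integral_ge0 => w _; rewrite lee_fin besov_density_ge0. Qed.

(** The density comparison is integrated over a square centered at w whose
    points keep a distance at least rho to the unit circle, where rho is half
    the distance from w to that circle: the constant term contributes the area
    rho^2 divided by rho, and the other one at most rho S. *)
Lemma besov_bloch (p S : R) (f : C -> C) (w : C) : 2 <= p -> 0 <= S ->
  holomorphic_disk f -> (besov_integral p f <= S%:E)%E -> unit_disk w ->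
  cmod (derive1 f w) * (1 - cmod w) <= 512 * (1 + S).
Proof.
move=> p2 S0 hf fS; rewrite unit_diskE => w1.
pose rho := (1 - cmod w) / 2; pose r := rho / 4.
have rho0 : 0 < rho by rewrite divr_gt0// subr_gt0.
have r0 : 0 < r by rewrite divr_gt0.
pose I := rho * (1 + S).
have I0 : 0 < I by rewrite mulr_gt0// ltr_wpDr.
pose Q := `[complex.Re w - 2 * r, complex.Re w + 2 * r] `*`
          `[complex.Im w - 2 * r, complex.Im w + 2 * r].
have Qrho q : Q q -> rho <= 1 - cmod (q.1 +i* q.2).
  move=> [] /=; rewrite !in_itv /= => q1 q2.
  have : cmod (q.1 +i* q.2 - w) <= 2 * r + 2 * r.
    apply: le_trans (cmod_le_ReIm _) _; rewrite cReB cImB /=.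
    by apply: lerD; rewrite ler_distl.
  have := cmodD (q.1 +i* q.2 - w) w; rewrite subrK /r /rho.
  move: (cmod _) (cmod (_ - _)) (cmod _) => *; lra.
have Qdisk q : Q q -> unit_disk (q.1 +i* q.2).
  by move=> /Qrho; rewrite unit_diskE => h; rewrite -subr_gt0 (lt_le_trans rho0).
pose G (q : R * R) := cmod (derive1 f (q.1 +i* q.2)) `^ p *
              (1 - cmod (q.1 +i* q.2) ^+ 2) `^ (p - 2).
have mQ : measurable Q by apply: measurableX.
have mD : measurable [set q : R * R | unit_disk (q.1 +i* q.2)].
  by apply: (@planar_open_measurable R (@unit_disk R)); exact: unit_disk_open.
have mGD : measurable_fun [set q : R * R | unit_disk (q.1 +i* q.2)] (EFin \o G).
  by apply/measurable_EFinP; exact: besov_density_measurable.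
have mG : measurable_fun Q (EFin \o G) by apply: measurable_funS mGD.
have G0 q : (0 <= (EFin \o G) q)%E by rewrite lee_fin besov_density_ge0.
have GS : (\int[mu \x mu]_(q in Q) (EFin \o G) q <= S%:E)%E.
  by apply: le_trans fS; apply: ge0_subset_integral.
have main : (\int[mu \x mu]_(q in Q) (cmod (derive1 f (q.1 +i* q.2)))%:E <= I%:E)%E.
  apply: (@le_trans _ _ (\int[mu \x mu]_(q in Q) (rho^-1%:E + rho%:E * (EFin \o G) q))%E).
    apply: ge0_le_integral => //.
    - by move=> q _; rewrite lee_fin cmod_ge0.
    - apply/measurable_EFinP; exact: measurable_funS (derive1_measurable hf).
    - by apply: emeasurable_funD => //; apply: measurable_funeM.
    - move=> q /Qrho qr; rewrite -EFinM -EFinD lee_fin.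
      apply: le_besov_density => //; first exact: cmod_ge0.
      have q1 : cmod (q.1 +i* q.2) <= 1.
        by rewrite -subr_ge0 (le_trans (ltW rho0)).
      by apply: le_trans qr _; rewrite lerD2l lerN2 expr2 ler_piMr ?cmod_ge0.
  rewrite ge0_integralD//; last 3 first.
  - by move=> q _; rewrite lee_fin invr_ge0 ltW.
  - by move=> q _; rewrite mule_ge0// lee_fin ltW.
  - exact: measurable_funeM.
  rewrite ge0_integralZl//; last by rewrite lee_fin ltW.
  have muQ : (mu \x mu)%E Q = (rho * rho)%:E.
    have muI t : mu `[t - 2 * r, t + 2 * r] = rho%:E.
      have lt : t - 2 * r < t + 2 * r by lra.
      rewrite lebesgue_measure_itv /= lte_fin lt -EFinD; congr EFin.
      by rewrite /r; field.
    by rewrite /Q product_measure1E// EFinM; congr (_ * _)%E; exact: muI.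
  have cQ : (\int[mu \x mu]_(q in Q) rho^-1%:E = rho%:E)%E.
    rewrite (@integral_cst _ _ _ (mu \x mu)%E _ mQ rho^-1%:E).
    apply: eq_trans (congr1 (fun x => (rho^-1%:E * x)%E) muQ) _.
    by rewrite -EFinM mulrA mulVf ?gt_eqF// mul1r.
  rewrite cQ /I mulrDr mulr1 EFinD (EFinM rho S).
  apply: leeD => //; apply: lee_wpmul2l => //; first by rewrite lee_fin ltW.
have := derive1_le_area r0 I0 hf Qdisk main.
rewrite /I /r => H.
have {}H : rho * cmod (derive1 f w) <= 256 * (1 + S).
  rewrite -(ler_pM2l rho0); move: H; rewrite expr_div_n.
  by move: (cmod (derive1 f w)) => x; nra.
have -> : 1 - cmod w = 2 * rho by rewrite /rho; field.
by rewrite mulrC; lra.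
Qed.
End BesovBloch.

(** * The Schwarz-Pick inequality and iteration *)

Section Composition.
Variable R : realType.
Notation C := (R[i]^o).

Lemma is_derive_comp (K : numFieldType) (g h : K^o -> K^o) (z : K^o) :
  derivable h z 1 -> derivable g (h z) 1 ->
  is_derive z 1 (g \o h) (derive1 g (h z) * derive1 h z).
Proof.
move=> /derivable1_diffP dh /derivable1_diffP dg.
have dgh : differentiable (g \o h) z by exact: differentiable_comp.
apply: DeriveDef; first exact/derivable1_diffP.
rewrite -derive1E derive1E' // diff_comp // !derive1E' //= -[X in 'd  _ _ X = _]mulr1.
by rewrite [LHS]linearZ mulrC.
Qed.

Lemma cmod_sqr (z : R[i]) : cmod z ^+ 2 = complex.Re z ^+ 2 + complex.Im z ^+ 2.
Proof. by rewrite cmodE sqr_sqrtr// addr_ge0// sqr_ge0. Qed.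

(** The Moebius map that sends a to 0 maps the disk into itself, by the
    identity |1 - a^* b|^2 - |b - a|^2 = (1 - |a|^2) (1 - |b|^2). *)
Lemma cmod_moebius_lt1 (a b : R[i]) : cmod a < 1 -> cmod b < 1 ->
  1 - conjc a * b != 0 /\ cmod ((b - a) / (1 - conjc a * b)) < 1.
Proof.
move=> a1 b1.
have lt : cmod (b - a) ^+ 2 < cmod (1 - conjc a * b) ^+ 2.
  rewrite -subr_gt0.
  have -> : cmod (1 - conjc a * b) ^+ 2 - cmod (b - a) ^+ 2 =
      (1 - cmod a ^+ 2) * (1 - cmod b ^+ 2).
    by rewrite !cmod_sqr; case: a a1 => ax ay _; case: b b1 => bx b_y _ /=; ring.
  by rewrite mulr_gt0// subr_gt0 exprn_ilt1// cmod_ge0.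
have {}lt : cmod (b - a) < cmod (1 - conjc a * b).
  by rewrite -(ltr_pXn2r (ltn0Sn 1)) ?nnegrE ?cmod_ge0.
have n0 : 0 < cmod (1 - conjc a * b) by apply: le_lt_trans lt; exact: cmod_ge0.
split; first by rewrite -cmod_gt0.
by rewrite cmodM cmodV ltr_pdivrMr// mul1r.
Qed.

(** Schwarz-Pick at the origin, up to a constant: Cauchy's estimate applies to
    the self-map composed with the automorphism that sends its value at 0
    to 0. *)
Lemma self_map_derive1_le (phi : R[i] -> R[i]) : self_map_disk phi ->
  cmod (derive1 (phi : C -> C) 0) <= 96 * (1 - cmod (phi 0)).
Proof.
move=> [hphi sphi]; set a := phi 0.
have d0 : unit_disk (0 : R[i]) by rewrite unit_diskE cmod0.
have a1 : cmod a < 1 by rewrite -unit_diskE; exact: sphi.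
have moeb z : unit_disk z -> 1 - conjc a * phi z != 0 /\
    cmod ((phi z - a) / (1 - conjc a * phi z)) < 1.
  by move=> /sphi; rewrite unit_diskE; exact: cmod_moebius_lt1.
pose psi := fun z : C => (phi z - a) / (1 - conjc a * phi z) : C.
have dpsi z : unit_disk z -> is_derive (z : C) 1 psi
    (derive1 (phi : C -> C) z / (1 - conjc a * phi z) -
     (phi z - a) * (- (conjc a * derive1 (phi : C -> C) z)) /
       (1 - conjc a * phi z) ^+ 2).
  move=> z1; have [n0 _] := moeb z z1.
  have dphi := is_derive_derive1 (hphi z z1).
  have dg : is_derive (z : C) 1 (fun u : C => phi u - a : C) (derive1 (phi : C -> C) z).
    by apply: is_derive_eq; rewrite subr0.
  have dm : is_derive (z : C) 1 (fun u : C => conjc a * phi u : C)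
      (conjc a * derive1 (phi : C -> C) z).
    have := is_deriveM (is_derive_cst (conjc a : C) (z : C) 1) dphi.
    by move=> /is_derive_eq; apply; rewrite /GRing.scale /= mulr0 addr0.
  have dh : is_derive (z : C) 1 (fun u : C => 1 - conjc a * phi u : C)
      (- (conjc a * derive1 (phi : C -> C) z)).
    have := is_deriveB (is_derive_cst (1 : C) (z : C) 1) dm.
    by move=> /is_derive_eq; apply; rewrite sub0r.
  exact: (@is_derive_div R[i] _ _ z _ _ n0 dg dh).
have psi0 : psi 0 = 0 by rewrite /psi -/a subrr mul0r.
have third : 0 < 3^-1 :> R by rewrite invr_gt0.
have near0 z : rectangle (complex.Re (0 : R[i]) - 3^-1) (complex.Re (0 : R[i]) + 3^-1)
    (complex.Im (0 : R[i]) - 3^-1) (complex.Im (0 : R[i]) + 3^-1) z -> unit_disk z.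
  move=> /= []; rewrite -!ler_distl !subr0 => zx zy; rewrite unit_diskE.
  apply: le_lt_trans (cmod_le_ReIm z) _; lra.
have est : cmod (derive1 psi 0) <= 16 * 1 / 3^-1.
  apply: (cauchy_estimate third) => z /near0 z1; first by have [] := dpsi z z1.
  by rewrite psi0 subr0 ltW//; have [] := moeb z z1.
have aa : 1 - conjc a * a = (1 - cmod a ^+ 2)%:C.
  by rewrite cmod_sqr; case: (a) => x y; apply/eqP; rewrite eq_complex /=;
    apply/andP; split; apply/eqP; ring.
have q0 : 0 < 1 - cmod a ^+ 2 by rewrite subr_gt0 exprn_ilt1// cmod_ge0.
move: est; rewrite (is_derive_derive1E (dpsi 0 d0)) -/a subrr mul0r mul0r subr0.
rewrite aa cmodM cmodV cmod_real gtr0_norm// ler_pdivrMr// => est.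
apply: le_trans est _; rewrite invrK.
by have := cmod_ge0 a; move: (cmod a) a1 => t t1 t0; nra.
Qed.

Lemma self_map_comp (phi psi : R[i] -> R[i]) :
  self_map_disk phi -> self_map_disk psi -> self_map_disk (phi \o psi).
Proof.
move=> [hphi sphi] [hpsi spsi]; split => z z1; last by apply: sphi; exact: spsi.
by have [] := @is_derive_comp R[i] phi psi z (hpsi z z1) (hphi _ (spsi z z1)).
Qed.

Lemma self_map_iter (phi : R[i] -> R[i]) n :
  self_map_disk phi -> self_map_disk (iter n phi).
Proof.
move=> sphi; elim: n => [|n ih]; first by split => // z _; exact: derivable_id.
exact: (self_map_comp sphi ih).
Qed.

Lemma iter_composition_operator (phi : R[i] -> R[i]) (f : R[i] -> C) n :
  iter n (composition_operator phi) f = f \o iter n phi.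
Proof.
elim: n => // n ih; rewrite iterS ih; apply/funext => z.
by rewrite /composition_operator /= -iterS iterSr.
Qed.

End Composition.

(** * The test functions z |-> l z *)

Section Targets.
Variable R : realType.
Notation C := (R[i]^o).
Notation mu := (@lebesgue_measure R).

Lemma is_derive_scale (l z : C) : is_derive z 1 (fun u : C => l * u : C) l.
Proof.
apply/derive_cmodP => e e0; exists 1 => // w _.
by rewrite -mulrBr mulrC subrr cmod0 mulr_ge0 ?cmod_ge0// ltW.
Qed.

Lemma besov_scale (p : R) (l : C) : 2 <= p -> besov p (fun z : R[i] => l * z : C).
Proof.
move=> p2; split; first by move=> z _; have [] := is_derive_scale l z.
have mD : measurable [set q : R * R | unit_disk (q.1 +i* q.2)].
  by apply: (@planar_open_measurable R (@unit_disk R)); exact: unit_disk_open.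
have hl : holomorphic_disk (fun z : R[i] => l * z : C).
  by move=> z _; have [] := is_derive_scale l z.
apply: (@le_lt_trans _ _ (\int[mu \x mu]_(q in [set q : R * R | unit_disk (q.1 +i* q.2)])
   (cmod l `^ p)%:E)%E).
  apply: ge0_le_integral => //.
  - by move=> q _; rewrite lee_fin besov_density_ge0.
  - by apply/measurable_EFinP; exact: besov_density_measurable.
  - move=> q; rewrite /= unit_diskE => q1; rewrite lee_fin.
    rewrite (is_derive_derive1E (is_derive_scale l _)) ler_piMr ?powR_ge0//.
    have c0 := cmod_ge0 (q.1 +i* q.2).
    rewrite -[leRHS](_ : 1 `^ (p - 2) = 1); last by rewrite powR1.
    by apply: ge0_ler_powR; rewrite ?nnegrE ?subr_ge0// ?gerBl ?sqr_ge0// exprn_ile1// ltW.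
rewrite (@integral_cst _ _ _ (mu \x mu)%E _ mD (cmod l `^ p)%:E).
apply: lte_mul_pinfty => //; first by rewrite lee_fin powR_ge0.
pose Q := `[-1, 1]%classic `*` `[-1, 1]%classic : set (R * R).
have mQ : measurable Q by apply: measurableX.
apply: (@le_lt_trans _ _ ((mu \x mu)%E Q)).
  apply: le_measure; rewrite ?inE// => q /=; rewrite unit_diskE => q1.
  have := le_lt_trans (normRe_le _) q1; have := le_lt_trans (normIm_le _) q1.
  by rewrite !ltr_norml /= => /andP[? ?] /andP[? ?]; split; rewrite /= in_itv /=;
    apply/andP; split; exact: ltW.
have muI : (mu `[(-1)%R, 1%R] = 2%:E)%E.
  have lt : -1 < 1 :> R by lra.
  by rewrite lebesgue_measure_itv /= lte_fin lt -EFinD opprK.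
have muQ : (mu \x mu)%E Q = (2 * 2)%:E.
  by rewrite /Q product_measure1E// EFinM; congr (_ * _)%E; exact: muI.
by apply: le_lt_trans (_ : (2 * 2)%:E < +oo)%E; [rewrite -muQ|exact: ltry].
Qed.

Lemma besov_norm_lt1 (p : R) (f : R[i] -> C) : 0 < p ->
  (besov_norm p f < 1%:E)%E -> (besov_integral p f <= 1%:E)%E.
Proof.
move=> p0; apply: contraTT; rewrite -ltNge -leNgt => S1.
rewrite /besov_norm -(poweR1r p^-1).
apply: gt0_ler_poweR; rewrite ?invr_ge0 ?(ltW p0)//.
- by rewrite in_itv /= leey andbT lee_fin.
- by rewrite in_itv /= leey andbT adde_ge0// ?lee_fin ?powR_ge0// besov_integral_ge0.
- by apply: le_trans (ltW S1) _; rewrite leeDr// lee_fin powR_ge0.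
Qed.

End Targets.

Theorem theorem4p2 (R : realType) (p : R) (phi : R[i] -> R[i]) :
  2 <= p ->
  self_map_disk phi ->
  ~ aut_disk phi ->
  (forall z : R[i], unit_disk z -> phi z <> z) ->
  bounded_operator (besov p) (besov_norm p) (composition_operator phi) ->
  ~ hypercyclic (besov p) (besov_norm p) (composition_operator phi).
Proof.
move=> p2 sphi _ _ _ [f [hf fS] orbit].
pose S := fine (besov_integral p f).
have S0 : 0 <= S by rewrite fine_ge0// besov_integral_ge0.
have SE : (besov_integral p f <= S%:E)%E.
  by rewrite fineK// ge0_fin_numE// besov_integral_ge0.
have d0 : unit_disk (0 : R[i]) by rewrite unit_diskE cmod0.
(* B bounds the derivatives at 0 along the orbit. *)
pose B := 96 * (512 * (1 + S)).
have B0 : 0 <= B by rewrite /B; lra.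
have p0 : 0 < p by lra.
(* 1024 is the Bloch bound 512 (1 + S) at 0 for a Besov integral S = 1. *)
pose l := B + 1025; have l0 : 0 <= l by rewrite /l; lra.
pose g := fun z : R[i] => l%:C * z : R[i]^o.
have [n] := orbit g (besov_scale l%:C p2) 1 ltr01.
rewrite iter_composition_operator.
set F := f \o iter n phi => /(besov_norm_lt1 p0) hS.
have [hn sn] := self_map_iter n sphi.
have dF : is_derive (0 : R[i]^o) 1 F
    (derive1 f (iter n phi 0) * derive1 (iter n phi : R[i]^o -> R[i]^o) 0).
  by apply: (@is_derive_comp R[i] f (iter n phi)); [exact: hn|apply: hf; exact: sn].
have FB : cmod (derive1 F 0) <= B.
  rewrite (is_derive_derive1E dF) cmodM.
  have w1 := sn _ d0.
  apply: (@le_trans _ _ (96 * (cmod (derive1 f (iter n phi 0)) * (1 - cmod (iter n phi 0))))).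
    rewrite mulrCA ler_wpM2l ?cmod_ge0//.
    by apply: self_map_derive1_le.
  by rewrite ler_pM2l// (besov_bloch p2 S0 hf SE).
have hh : holomorphic_disk (F - g).
  move=> z z1; apply: derivableB; last by have [] := is_derive_scale l%:C z.
  by have [] := @is_derive_comp R[i] f (iter n phi) z (hn z z1) (hf _ (sn z z1)).
have dh : is_derive (0 : R[i]^o) 1 (F - g) (derive1 F 0 - l%:C).
  apply: is_deriveB; last exact: is_derive_scale.
  by apply: is_derive_derive1; case: dF.
have := besov_bloch p2 ler01 hh hS d0.
rewrite (is_derive_derive1E dh) cmod0 subr0 mulr1 => hB.
have : cmod (l%:C : R[i]) <= cmod (derive1 F 0) + cmod (derive1 F 0 - l%:C).
  by rewrite -[in leLHS](subKr (derive1 F 0) l%:C) cmodB.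
rewrite cmod_real (ger0_norm l0) /l => hl; lra.
Qed.
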